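(* Let $X$ be a Banach space with property $( * )$ and $Y\subset X$ a closed linear subspace. Let $f:Y\to\mathbb{R}$ be $\mathcal{C}^1$-smooth and $F:X\to\mathbb{R}$ a continuous extension of $f$. Then for every $\varepsilon>0$ there is a $\mathcal{C}^1$-smooth $G:X\to\mathbb{R}$ such that, with $g=G|_Y$, (i) $|F(x)-G(x)|<\varepsilon$ for all $x\in X$, and (ii) $\|f'(y)-g'(y)\|_{Y^*}<\varepsilon$ for all $y\in Y$. (iii) Furthermore, there is a constant $C_2$ depending only on $X$ such that if $f$ is Lipschitz on $Y$ and $F$ is a Lipschitz extension of $f$ to $X$, then $G$ can be chosen, in addition to (i) and (ii), Lipschitz on $X$ with $\operatorname{Lip}(G)\le C_2\operatorname{Lip}(F)$.
   Context: A Banach space $X$ has property $( * )$ if there is a constant $C_0$, depending only on $X$, such that for every Lipschitz function $f:X\to\mathbb{R}$ and every $\varepsilon>0$ there is a Lipschitz, $\mathcal{C}^1$-smooth function $K:X\to\mathbb{R}$ with $|f(x)-K(x)|<\varepsilon$ for all $x\in X$ and $\operatorname{Lip}(K)\le C_0\operatorname{Lip}(f)$. *)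

(* Defs.v *)
From Stdlib Require Import Reals Lra.
Open Scope R_scope.

Record NormedSpace := {
  V :> Type;
  vzero : V;
  vadd : V -> V -> V;
  vopp : V -> V;
  vscal : R -> V -> V;
  vnorm : V -> R;
  vadd_assoc : forall x y z, vadd x (vadd y z) = vadd (vadd x y) z;
  vadd_comm : forall x y, vadd x y = vadd y x;
  vadd_0 : forall x, vadd x vzero = x;
  vadd_opp : forall x, vadd x (vopp x) = vzero;
  vscal_1 : forall x, vscal 1 x = x;
  vscal_assoc : forall a b x, vscal a (vscal b x) = vscal (a * b) x;
  vscal_distr_v : forall a x y, vscal a (vadd x y) = vadd (vscal a x) (vscal a y);
  vscal_distr_r : forall a b x, vscal (a + b) x = vadd (vscal a x) (vscal b x);
  vnorm_eq0 : forall x, vnorm x = 0 -> x = vzero;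
  vnorm_triangle : forall x y, vnorm (vadd x y) <= vnorm x + vnorm y;
  vnorm_scal : forall a x, vnorm (vscal a x) = Rabs a * vnorm x
}.

Arguments vzero {_}.
Arguments vadd {_} _ _.
Arguments vopp {_} _.
Arguments vscal {_} _ _.
Arguments vnorm {_} _.

Definition vsub {X : NormedSpace} (x y : X) : X := vadd x (vopp y).

Definition is_Banach (X : NormedSpace) : Prop :=
  forall u : nat -> X,
    (forall eps, 0 < eps -> exists N, forall m n, (N <= m)%nat -> (N <= n)%nat ->
        vnorm (vsub (u m) (u n)) < eps) ->
    exists l : X, forall eps, 0 < eps -> exists N, forall n, (N <= n)%nat ->
        vnorm (vsub (u n) l) < eps.

Definition is_linear_subspace {X : NormedSpace} (P : X -> Prop) : Prop :=
  P vzero /\ (forall x y, P x -> P y -> P (vadd x y)) /\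
  (forall a x, P x -> P (vscal a x)).

Definition is_closed_set {X : NormedSpace} (P : X -> Prop) : Prop :=
  forall (u : nat -> X) (l : X), (forall n, P (u n)) ->
    (forall eps, 0 < eps -> exists N, forall n, (N <= n)%nat -> vnorm (vsub (u n) l) < eps) ->
    P l.

Definition whole {X : NormedSpace} : X -> Prop := fun _ => True.

Definition linear_on {X : NormedSpace} (P : X -> Prop) (L : X -> R) : Prop :=
  (forall x y, P x -> P y -> L (vadd x y) = L x + L y) /\
  (forall a x, P x -> L (vscal a x) = a * L x).

Definition dual_bound {X : NormedSpace} (P : X -> Prop) (L : X -> R) (c : R) : Prop :=
  forall h, P h -> Rabs (L h) <= c * vnorm h.

(** ||L||_{P^*} < eps  (the dual norm is the least bound, so this is equivalent to
    the existence of a bound strictly below eps). *)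
Definition dual_norm_lt {X : NormedSpace} (P : X -> Prop) (L : X -> R) (eps : R) : Prop :=
  exists c, c < eps /\ dual_bound P L c.

Definition frechet_on {X : NormedSpace} (P : X -> Prop) (f : X -> R) (y : X)
    (L : X -> R) : Prop :=
  linear_on P L /\ (exists c, dual_bound P L c) /\
  forall eps, 0 < eps -> exists delta, 0 < delta /\
    forall h, P h -> vnorm h < delta ->
      Rabs (f (vadd y h) - f y - L h) <= eps * vnorm h.

Definition C1_on {X : NormedSpace} (P : X -> Prop) (f : X -> R) (Df : X -> X -> R) : Prop :=
  (forall y, P y -> frechet_on P f y (Df y)) /\
  (forall y, P y -> forall eps, 0 < eps -> exists delta, 0 < delta /\
     forall z, P z -> vnorm (vsub z y) < delta ->
       dual_norm_lt P (fun h => Df z h - Df y h) eps).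

Definition is_C1 {X : NormedSpace} (f : X -> R) : Prop :=
  exists Df, C1_on whole f Df.

Definition continuous_on_X {X : NormedSpace} (F : X -> R) : Prop :=
  forall x eps, 0 < eps -> exists delta, 0 < delta /\
    forall z, vnorm (vsub z x) < delta -> Rabs (F z - F x) < eps.

Definition lipschitz_on {X : NormedSpace} (P : X -> Prop) (f : X -> R) (L : R) : Prop :=
  forall x y, P x -> P y -> Rabs (f x - f y) <= L * vnorm (vsub x y).

Definition is_Lip_on {X : NormedSpace} (P : X -> Prop) (f : X -> R) (L : R) : Prop :=
  lipschitz_on P f L /\ forall L', lipschitz_on P f L' -> L <= L'.

Definition property_star (X : NormedSpace) : Prop :=
  exists C0 : R, forall (f : X -> R) (Lf : R), is_Lip_on whole f Lf ->
    forall eps, 0 < eps -> exists K : X -> R,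
      is_C1 K /\ (forall x, Rabs (f x - K x) < eps) /\
      lipschitz_on whole K (C0 * Lf).

(* Main.v *)
From mathcomp Require ssreflect ssrfun ssrbool eqtype wochoice boolp classical_sets.
Require Import Defs.
From Stdlib Require Import Reals Lra Lia Classical ClassicalEpsilon.
Open Scope R_scope.

(** Cover X by balls B(p, r p) on which there are good C^1 models of F: near p in P,
    the first-order Taylor polynomial of f at p (its linear part extended to X by
    Hahn-Banach) plus a correction D. On P near p the remainder of f is eta-Lipschitz
    with eta small; D is a smoothing by the hypothesis on X of this remainder, so it approximates
    it on P as well as we please while its slope along P stays O(eta). Away from P, F itself
    (or a constant) is smoothed. M. E. Rudin's argument for Stone's theorem gives a C^1
    partition of unity (w_n), countably indexed, such that near each point of its support
    w_n sees a single ball. With the n-th model delta_n-accurate and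
    sum_n Lip(w_n) delta_n small, the derivatives of the w_n contribute almost nothing to
    the derivative of G = sum_n w_n K_n, because

      G(x+h) - G(x) - L h = sum w_n(x+h) (K_n(x+h) - K_n(x) - L h)
                            + sum (w_n(x+h) - w_n(x)) (K_n(x) - v)   for every v.

    Taking v = f(x), L = f'(x) gives (ii); taking v = F(x), L = 0 gives (iii). For (iii) the
    correction must be Lipschitz with constant O(Lip F) on X and O(eta) near P: glue two
    smoothings along a thin neighbourhood of P. *)

(** * Well-orders, used to choose the first ball of a cover *)

Section WellOrder.
Import ssreflect ssrfun ssrbool eqtype wochoice boolp.

Lemma exists_well_order (T : Type) : exists le : T -> T -> Prop,
  (forall x y, le x y -> le y x -> x = y) /\
  forall A : T -> Prop, (exists x, A x) -> exists z, A z /\ forall x, A x -> le z x.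
Proof.
(* [Peq] endows the bare type with a classical boolean equality, which the well-ordering principle
   asks for. *)
elim/Peq: T => T; have [le wo] := well_ordering_principle T.
exists le; split=> [x y xy yx|A [x Ax]].
  have chain : wo_chain le predT by move=> A _; exact: wo.
  by apply: (wo_chain_antisymmetric chain) => //; rewrite xy yx.
have [z [[Az zmin] _]] := wo (fun t => `[< A t >]) (ex_intro _ x (asboolT Ax)).
exists z; split; first exact/asboolP.
by move=> y Ay; apply: zmin; exact/asboolP.
Qed.

End WellOrder.

(** * Vector algebra and the Hahn-Banach theorem *)

Section Vectors.
Context {X : NormedSpace}.
Implicit Types x y z : X.

Lemma vadd_0l x : vadd vzero x = x.
Proof. rewrite vadd_comm; apply vadd_0. Qed.

Lemma vadd_cancel x y z : vadd x y = vadd x z -> y = z.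
Proof.
intros E.
rewrite <- (vadd_0l y), <- (vadd_0l z), <- (vadd_opp _ x), (vadd_comm _ x).
rewrite <- !vadd_assoc. now rewrite E.
Qed.

Lemma vscal_0 x : vscal 0 x = vzero.
Proof.
apply (vadd_cancel x). rewrite vadd_0. rewrite <- (vscal_1 _ x) at 1.
rewrite <- vscal_distr_r. replace (1 + 0) with 1 by ring. apply vscal_1.
Qed.

Lemma vopp_scal x : vopp x = vscal (-1) x.
Proof.
apply (vadd_cancel x). rewrite vadd_opp. rewrite <- (vscal_1 _ x) at 1.
rewrite <- vscal_distr_r. replace (1 + -1) with 0 by ring. now rewrite vscal_0.
Qed.

Lemma vadd_swap (a b c d : X) : vadd (vadd a b) (vadd c d) = vadd (vadd a c) (vadd b d).
Proof.
rewrite <- !vadd_assoc. f_equal. rewrite !vadd_assoc. f_equal. apply vadd_comm.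
Qed.

Lemma vsub_self x : vsub x x = vzero.
Proof. apply vadd_opp. Qed.

Lemma vadd_vsub x y : vadd x (vsub y x) = y.
Proof. unfold vsub. rewrite (vadd_comm _ y), vadd_assoc, vadd_opp. apply vadd_0l. Qed.

Lemma vsub_vadd x h : vsub (vadd x h) x = h.
Proof. apply (vadd_cancel x). apply vadd_vsub. Qed.

Lemma vsub_add_r x y z : vadd (vsub x y) (vadd z y) = vadd x z.
Proof.
unfold vsub. rewrite vadd_swap, (vadd_comm _ (vopp y)), vadd_opp. apply vadd_0.
Qed.

Lemma vsub_chain x y z : vadd (vsub x y) (vsub y z) = vsub x z.
Proof.
change (vsub y z) with (vadd y (vopp z)). rewrite (vadd_comm _ y). apply vsub_add_r.
Qed.

Lemma vsub_add x y h : vsub (vadd x h) y = vadd (vsub x y) h.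
Proof. unfold vsub. rewrite <- !vadd_assoc. f_equal. apply vadd_comm. Qed.

Lemma vnorm_0 : vnorm (vzero : X) = 0.
Proof. rewrite <- (vscal_0 vzero), vnorm_scal, Rabs_R0. ring. Qed.

Lemma vnorm_opp x : vnorm (vopp x) = vnorm x.
Proof. rewrite vopp_scal, vnorm_scal, Rabs_left by lra. ring. Qed.

Lemma vnorm_ge0 x : 0 <= vnorm x.
Proof.
pose proof (vnorm_triangle _ x (vopp x)) as H.
rewrite vadd_opp, vnorm_0, vnorm_opp in H. lra.
Qed.

Lemma vsub_opp x y : vsub y x = vopp (vsub x y).
Proof.
apply (vadd_cancel (vsub x y)). rewrite vsub_chain, vsub_self, vadd_opp. reflexivity.
Qed.

Lemma vdist_sym x y : vnorm (vsub x y) = vnorm (vsub y x).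
Proof. now rewrite (vsub_opp x y), vnorm_opp. Qed.

Lemma vdist_triangle x y z :
  vnorm (vsub x z) <= vnorm (vsub x y) + vnorm (vsub y z).
Proof. rewrite <- (vsub_chain x y z). apply vnorm_triangle. Qed.

Lemma vdist_self x : vnorm (vsub x x) = 0.
Proof. rewrite vsub_self. apply vnorm_0. Qed.

Lemma vdist_eq0 x y : vnorm (vsub x y) = 0 -> x = y.
Proof.
intros H. apply vnorm_eq0 in H. rewrite <- (vadd_vsub y x), H. apply vadd_0.
Qed.

(* A linear functional on a subspace is encoded as its graph, a linear subspace of X * R; the bound makes the graph single-valued. *)
Definition dominated_graph (M : R) (G0 G : X * R -> Prop) : Prop :=
  (forall u v, G u -> G v -> G (vadd (fst u) (fst v), snd u + snd v)) /\
  (forall t u, G u -> G (vscal t (fst u), t * snd u)) /\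
  (forall u, G u -> snd u <= M * vnorm (fst u)) /\
  (forall u, G u -> forall v, G0 v -> G v).

(** The one-dimensional step of Hahn-Banach. The value [c] at [x0] must lie above every
    [snd u - M * vnorm (vsub (fst u) x0)] and below every [M * vnorm (vadd (fst u) x0) - snd u]. The
    triangle inequality puts each lower bound below each upper one; [c] is the supremum of the lower
    bounds. *)
Lemma dominated_graph_extend M G0 G x0 :
  0 <= M -> (exists u, G u) -> dominated_graph M G0 G ->
  exists G', dominated_graph M G0 G' /\ (forall u, G u -> G' u) /\
    exists a, G' (x0, a).
Proof.
intros HM [u0 Hu0] (Hadd & Hscal & Hdom & Hext).
destruct (completeness (fun r => exists u, G u /\ r = snd u - M * vnorm (vsub (fst u) x0)))
  as [c [Hub Hlub]].
- exists (M * vnorm (vadd (fst u0) x0) - snd u0).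
  intros r (u & Hu & ->).
  pose proof (Hdom _ (Hadd _ _ Hu Hu0)) as H. simpl in H.
  rewrite <- (vsub_add_r (fst u) x0 (fst u0)) in H.
  pose proof (vnorm_triangle _ (vsub (fst u) x0) (vadd (fst u0) x0)) as H'.
  apply (Rmult_le_compat_l M) in H'; [|exact HM]. lra.
- exists (snd u0 - M * vnorm (vsub (fst u0) x0)), u0. auto.
- assert (Hc1 : forall u, G u -> snd u - c <= M * vnorm (vsub (fst u) x0)).
  { intros u Hu. assert (H := Hub _ (ex_intro _ u (conj Hu eq_refl))). lra. }
  assert (Hc2 : forall u, G u -> snd u + c <= M * vnorm (vadd (fst u) x0)).
  { intros u Hu. assert (H : c <= M * vnorm (vadd (fst u) x0) - snd u); [|lra].
    apply Hlub. intros r (v & Hv & ->).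
    pose proof (Hdom _ (Hadd _ _ Hv Hu)) as H. simpl in H.
    rewrite <- (vsub_add_r (fst v) x0 (fst u)) in H.
    pose proof (vnorm_triangle _ (vsub (fst v) x0) (vadd (fst u) x0)) as H'.
    apply (Rmult_le_compat_l M) in H'; [|exact HM]. lra. }
  exists (fun w => exists u t, G u /\ w = (vadd (fst u) (vscal t x0), snd u + t * c)).
  split; [repeat split|split].
  + intros w w' (u & t & Hu & ->) (v & s & Hv & ->). simpl.
    exists (vadd (fst u) (fst v), snd u + snd v), (t + s). split; [now apply Hadd|].
    simpl. rewrite vadd_swap, vscal_distr_r. f_equal. ring.
  + intros s w (u & t & Hu & ->). simpl.
    exists (vscal s (fst u), s * snd u), (s * t). split; [now apply Hscal|].
    simpl. rewrite vscal_distr_v, vscal_assoc. f_equal. ring.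
  + intros w (u & t & Hu & ->). simpl.
    (* By homogeneity, dividing by [Rabs t] reduces the bound to [t = -1] ([Hc1]) or [t = 1]
       ([Hc2]). *)
    destruct (Rtotal_order t 0) as [Ht|[->|Ht]].
    * pose proof (Hc1 _ (Hscal (/ - t) _ Hu)) as H. simpl in H.
      replace (vadd (fst u) (vscal t x0)) with
        (vscal (- t) (vsub (vscal (/ - t) (fst u)) x0)).
      2:{ unfold vsub. rewrite vscal_distr_v, vopp_scal, !vscal_assoc.
          replace (- t * / - t) with 1 by (field; lra). rewrite vscal_1.
          f_equal. f_equal. ring. }
      rewrite vnorm_scal, Rabs_pos_eq by lra.
      apply (Rmult_le_compat_l (- t)) in H; [|lra].
      replace (- t * (/ - t * snd u - c)) with (snd u + t * c) in H by (field; lra).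
      lra.
    * pose proof (Hdom _ Hu). rewrite vscal_0, vadd_0. lra.
    * pose proof (Hc2 _ (Hscal (/ t) _ Hu)) as H. simpl in H.
      replace (vadd (fst u) (vscal t x0)) with
        (vscal t (vadd (vscal (/ t) (fst u)) x0)).
      2:{ rewrite vscal_distr_v, !vscal_assoc.
          replace (t * / t) with 1 by (field; lra). now rewrite vscal_1. }
      rewrite vnorm_scal, Rabs_pos_eq by lra.
      apply (Rmult_le_compat_l t) in H; [|lra].
      replace (t * (/ t * snd u + c)) with (snd u + t * c) in H by (field; lra).
      lra.
  + intros _ _ v Hv. exists v, 0. split; [now apply (Hext u0)|].
    destruct v as [y b]; simpl. rewrite vscal_0, vadd_0. f_equal. ring.
  + intros [y b] Hu. exists (y, b), 0. split; [exact Hu|].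
    simpl. rewrite vscal_0, vadd_0. f_equal. ring.
  + exists c, (vscal 0 (fst u0), 0 * snd u0), 1. split; [now apply Hscal|].
    simpl. rewrite vscal_0, vadd_0l, vscal_1. f_equal. ring.
Qed.

(** Zorn's lemma gives a maximal dominated graph, and the one-dimensional step forces its domain to
    be all of [X]. *)
Theorem hahn_banach (P : X -> Prop) (L : X -> R) (M : R) :
  is_linear_subspace P -> linear_on P L -> 0 <= M -> dual_bound P L M ->
  exists Lam : X -> R,
    linear_on whole Lam /\ dual_bound whole Lam M /\ forall y, P y -> Lam y = L y.
Proof.
intros (P0 & Padd & Pscal) [Ladd Lscal] HM HL.
set (G0 := fun u : X * R => P (fst u) /\ snd u = L (fst u)).
destruct (classical_sets.Zorn_bigcup (P := dominated_graph M G0)) as [G [HG Gmax]].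
- intros F HF Htot.
  assert (Hpair : forall A B, F A -> F B ->
    (forall u, A u -> B u) \/ (forall u, B u -> A u)).
  { intros A B HA HB. destruct (Htot A B HA HB); auto. }
  repeat split.
  + intros u v [A HA Au] [B HB Bv].
    destruct (Hpair A B HA HB) as [H|H].
    * exists B; [exact HB|]. apply (HF B HB); auto.
    * exists A; [exact HA|]. apply (HF A HA); auto.
  + intros t u [A HA Au]. exists A; [exact HA|]. now apply (HF A HA).
  + intros u [A HA Au]. now apply (HF A HA).
  + intros u [A HA Au] v Hv. exists A; [exact HA|].
    destruct (HF A HA) as (_ & _ & _ & Hext). now apply (Hext u).
- assert (HG0 : dominated_graph M G0 G0).
  { unfold G0. split; [|split; [|split]].
    - intros u v [Pu ->] [Pv ->]; simpl. split; [now apply Padd|].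
      symmetry; now apply Ladd.
    - intros t u [Pu ->]; simpl. split; [now apply Pscal|].
      symmetry; now apply Lscal.
    - intros u [Pu ->]. pose proof (HL _ Pu). pose proof (Rle_abs (L (fst u))). lra.
    - auto. }
  (* The extension clause of [dominated_graph] binds inhabited graphs only, so that the union of the
     empty chain is admissible. Hence the maximal graph must be shown inhabited: otherwise [G0]
     would be strictly larger. *)
  assert (Gne : exists u, G u).
  { apply NNPP. intros Hn. apply (Gmax G0); [|exact HG0]. split.
    - intros u Hu. exfalso. eauto.
    - intros H. apply Hn. exists (vzero, L vzero). apply H. split; auto. }
  assert (Hdef : forall x, exists a, G (x, a)).
  { intros x. destruct (dominated_graph_extend M G0 G x HM Gne HG)
      as (G' & HG' & Hsub & a & Ha).
    exists a. apply NNPP. intros Hn. apply (Gmax G'); [|exact HG'].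
    split; [exact Hsub|]. intros H. now apply Hn, H. }
  destruct HG as (Gadd & Gscal & Gdom & Gext).
  assert (Gabs : forall x a, G (x, a) -> Rabs a <= M * vnorm x).
  { intros x a Ha. pose proof (Gdom _ Ha) as H1.
    pose proof (Gdom _ (Gscal (-1) _ Ha)) as H2. simpl in *.
    rewrite vnorm_scal, Rabs_left in H2 by lra. apply Rabs_le. lra. }
  assert (Guniq : forall x a b, G (x, a) -> G (x, b) -> a = b).
  { intros x a b Ha Hb.
    pose proof (Gabs _ _ (Gadd _ _ Ha (Gscal (-1) _ Hb))) as H. simpl in H.
    rewrite <- vopp_scal, vadd_opp, vnorm_0 in H.
    pose proof (Rabs_pos (a + -1 * b)).
    destruct (Req_dec (a + -1 * b) 0) as [|Hne]; [lra|].
    apply Rabs_pos_lt in Hne. lra. }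
  set (Lam := fun x => proj1_sig (constructive_indefinite_description _ (Hdef x))).
  assert (HLam : forall x, G (x, Lam x)).
  { intros x. unfold Lam. apply proj2_sig. }
  exists Lam. repeat split.
  + intros x y _ _. apply (Guniq (vadd x y)); [apply HLam|].
    exact (Gadd _ _ (HLam x) (HLam y)).
  + intros a x _. apply (Guniq (vscal a x)); [apply HLam|].
    exact (Gscal a _ (HLam x)).
  + intros x _. apply Gabs, HLam.
  + intros y Py. apply (Guniq y); [apply HLam|].
    destruct Gne as [u Hu]. apply (Gext u Hu). now split.
Qed.

End Vectors.

(** * Differentiability *)

(** Continuous induction. Let [m] be the supremum of the times [t] up to which the increment of [g]
    from 0 is at most [(c + eps) * t]. The local bound at [m], used backwards, shows that [m] is
    such a time; used forwards, it excludes [m < 1]. *)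
Lemma local_lipschitz_unit_interval (g : R -> R) (c : R) :
  (forall t, 0 <= t <= 1 -> forall eps, 0 < eps -> exists delta, 0 < delta /\
    forall s, Rabs s < delta -> 0 <= t + s <= 1 ->
      Rabs (g (t + s) - g t) <= (c + eps) * Rabs s) ->
  Rabs (g 1 - g 0) <= c.
Proof.
intros Hloc. apply le_epsilon. intros eps Heps.
set (E := fun t => 0 <= t <= 1 /\ Rabs (g t - g 0) <= (c + eps) * t).
assert (E0 : E 0).
{ split; [lra|]. rewrite Rminus_diag, Rabs_R0. lra. }
destruct (completeness E) as [m [Hub Hlub]].
{ exists 1. intros t [Ht _]. lra. }
{ now exists 0. }
assert (Hm : 0 <= m <= 1).
{ split; [now apply Hub|]. apply Hlub. intros t [Ht _]. lra. }
destruct (Hloc m Hm eps Heps) as (delta & Hdelta & Hd).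
assert (Em : E m).
{ split; [exact Hm|].
  assert (exists t, E t /\ m - delta < t) as (t & [Ht Et] & Hlt).
  { apply NNPP. intros Hn. assert (m <= m - delta); [|lra].
    apply Hlub. intros t Et. apply Rnot_lt_le. intros H. apply Hn. eauto. }
  assert (t <= m) by (apply Hub; split; auto).
  assert (Ht' : Rabs (t - m) = m - t) by (rewrite Rabs_left1; lra).
  assert (H1 := Hd (t - m)). rewrite Ht' in H1.
  replace (m + (t - m)) with t in H1 by ring.
  specialize (H1 ltac:(lra) Ht).
  replace (g m - g 0) with ((g t - g 0) - (g t - g m)) by ring.
  pose proof (Rabs_triang (g t - g 0) (- (g t - g m))) as H2.
  rewrite Rabs_Ropp in H2. unfold Rminus in *. lra. }
destruct (Req_dec m 1) as [->|Hne].
{ destruct Em as [_ Em]. lra. }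
assert (Es : E (m + Rmin (delta / 2) (1 - m))).
{ set (s := Rmin (delta / 2) (1 - m)).
  assert (0 < s <= 1 - m /\ s < delta) as [Hs Hs'].
  { unfold s, Rmin. destruct Rle_dec; lra. }
  split; [lra|].
  assert (H1 := Hd s). rewrite Rabs_pos_eq in H1 by lra.
  specialize (H1 ltac:(lra) ltac:(lra)). destruct Em as [_ Em].
  replace (g (m + s) - g 0) with ((g (m + s) - g m) + (g m - g 0)) by ring.
  pose proof (Rabs_triang (g (m + s) - g m) (g m - g 0)). lra. }
apply Hub in Es.
assert (0 < Rmin (delta / 2) (1 - m)) by (apply Rmin_pos; lra). lra.
Qed.

Section Differentials.
Context {X : NormedSpace}.
Implicit Types (P : X -> Prop) (f g L : X -> R) (x y z h : X).

(* At x, along P, the function f - L has pointwise Lipschitz constant at most c; for c = 0 this is differentiability. *)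
Definition approx_at P f x L (c : R) : Prop :=
  forall eps, 0 < eps -> exists delta, 0 < delta /\
    forall h, P h -> vnorm h < delta ->
      Rabs (f (vadd x h) - f x - L h) <= (c + eps) * vnorm h.

Lemma frechet_approx_at P f x L : frechet_on P f x L -> approx_at P f x L 0.
Proof.
intros (_ & _ & H) eps Heps. destruct (H eps Heps) as (d & Hd & Hh).
exists d. split; [exact Hd|]. intros h Ph Hn. rewrite Rplus_0_l. auto.
Qed.

Lemma approx_at_weaken P (Q : X -> Prop) f x L c :
  (forall h, Q h -> P h) -> approx_at P f x L c -> approx_at Q f x L c.
Proof.
intros HPQ H eps Heps. destruct (H eps Heps) as (d & Hd & Hh).
exists d. split; [exact Hd|]. auto.
Qed.

Lemma lipschitz_approx_at f c x : lipschitz_on whole f c -> approx_at whole f x (fun _ => 0) c.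
Proof.
intros H eps Heps. exists 1. split; [lra|]. intros h _ _.
pose proof (H (vadd x h) x I I) as H1. rewrite vsub_vadd in H1.
pose proof (vnorm_ge0 h). rewrite Rminus_0_r.
apply (Rle_trans _ _ _ H1). apply Rmult_le_compat_r; lra.
Qed.

Lemma approx_at_change P f x L L' c c' :
  approx_at P f x L c -> (forall h, P h -> Rabs (L h - L' h) <= c' * vnorm h) ->
  approx_at P f x L' (c + c').
Proof.
intros H HL eps Heps. destruct (H eps Heps) as (d & Hd & Hh).
exists d. split; [exact Hd|]. intros h Ph Hn.
specialize (Hh h Ph Hn). specialize (HL h Ph).
replace (f (vadd x h) - f x - L' h) with
  ((f (vadd x h) - f x - L h) + (L h - L' h)) by ring.
pose proof (Rabs_triang (f (vadd x h) - f x - L h) (L h - L' h)). lra.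
Qed.

Lemma approx_at_add P f g x L L' c c' :
  approx_at P f x L c -> approx_at P g x L' c' ->
  approx_at P (fun z => f z + g z) x (fun h => L h + L' h) (c + c').
Proof.
intros H H' eps Heps.
destruct (H (eps / 2) ltac:(lra)) as (d & Hd & Hh).
destruct (H' (eps / 2) ltac:(lra)) as (d' & Hd' & Hh').
exists (Rmin d d'). split; [now apply Rmin_pos|]. intros h Ph Hn.
specialize (Hh h Ph (Rlt_le_trans _ _ _ Hn (Rmin_l _ _))).
specialize (Hh' h Ph (Rlt_le_trans _ _ _ Hn (Rmin_r _ _))).
replace (f (vadd x h) + g (vadd x h) - (f x + g x) - (L h + L' h)) with
  ((f (vadd x h) - f x - L h) + (g (vadd x h) - g x - L' h)) by ring.
pose proof (Rabs_triang (f (vadd x h) - f x - L h) (g (vadd x h) - g x - L' h)). lra.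
Qed.

(** Both expansions are tested on [vscal t h] with [t] small, and [t] cancels by linearity. With
    [c = c' = 0] this is uniqueness of the derivative; with one functional zero it bounds a
    derivative by a Lipschitz constant. *)
Lemma approx_at_unique P f x L L' c c' :
  is_linear_subspace P -> linear_on P L -> linear_on P L' ->
  approx_at P f x L c -> approx_at P f x L' c' ->
  forall h, P h -> Rabs (L h - L' h) <= (c + c') * vnorm h.
Proof.
intros (_ & _ & Pscal) [_ Ls] [_ Ls'] H H' h Ph.
apply le_epsilon. intros eps Heps.
set (e := eps / (2 * (vnorm h + 1))).
pose proof (vnorm_ge0 h) as Hh0.
assert (He : 0 < e) by (apply Rdiv_lt_0_compat; lra).
destruct (H e He) as (d & Hd & Hh).
destruct (H' e He) as (d' & Hd' & Hh').
set (t := Rmin d d' / (vnorm h + 1)).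
assert (Hm : 0 < Rmin d d') by now apply Rmin_pos.
assert (Ht : 0 < t) by (apply Rdiv_lt_0_compat; lra).
assert (Htn : vnorm (vscal t h) = t * vnorm h).
{ rewrite vnorm_scal, Rabs_pos_eq; lra. }
assert (Htlt : t * vnorm h < Rmin d d').
{ unfold t. apply Rmult_lt_reg_r with (vnorm h + 1); [lra|]. field_simplify; [|lra]. nra. }
specialize (Hh (vscal t h) (Pscal _ _ Ph)
  ltac:(rewrite Htn; apply (Rlt_le_trans _ _ _ Htlt), Rmin_l)).
specialize (Hh' (vscal t h) (Pscal _ _ Ph)
  ltac:(rewrite Htn; apply (Rlt_le_trans _ _ _ Htlt), Rmin_r)).
rewrite Htn, Ls in Hh by exact Ph. rewrite Htn, Ls' in Hh' by exact Ph.
set (a := f (vadd x (vscal t h)) - f x) in *.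
assert (Hd2 : t * Rabs (L h - L' h) <= t * ((c + c' + 2 * e) * vnorm h)).
{ rewrite <- (Rabs_pos_eq t) at 1 by lra. rewrite <- Rabs_mult.
  replace (t * (L h - L' h)) with (- (a - t * L h) + (a - t * L' h)) by ring.
  pose proof (Rabs_triang (- (a - t * L h)) (a - t * L' h)) as H1.
  rewrite Rabs_Ropp in H1. lra. }
apply Rmult_le_reg_l in Hd2; [|exact Ht].
assert (2 * e * vnorm h <= eps); [|lra].
unfold e. apply Rmult_le_reg_r with (vnorm h + 1); [lra|]. field_simplify; [|lra]. nra.
Qed.

(** A mean value inequality: the one-variable lemma is applied to [f - L] along the segment from [x]
    to [y]. *)
Lemma approx_at_segment P f L c x y :
  is_linear_subspace P -> linear_on P L -> P (vsub y x) ->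
  (forall t, 0 <= t <= 1 -> approx_at P f (vadd x (vscal t (vsub y x))) L c) ->
  Rabs (f y - f x - L (vsub y x)) <= c * vnorm (vsub y x).
Proof.
intros (_ & _ & Pscal) [_ Ls] Pv H. set (v := vsub y x) in *.
pose proof (local_lipschitz_unit_interval
  (fun t => f (vadd x (vscal t v)) - t * L v) (c * vnorm v)) as Hg.
simpl in Hg. rewrite vscal_1, vscal_0, vadd_0 in Hg.
replace (vadd x v) with y in Hg by (symmetry; apply vadd_vsub).
replace (f y - 1 * L v - (f x - 0 * L v)) with (f y - f x - L v) in Hg by ring.
apply Hg. clear Hg. intros t Ht eps Heps.
pose proof (vnorm_ge0 v) as Hv.
destruct (H t Ht (eps / (vnorm v + 1))) as (d & Hd & Hh).
{ apply Rdiv_lt_0_compat; lra. }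
exists (d / (vnorm v + 1)). split; [apply Rdiv_lt_0_compat; lra|].
intros s Hs _.
assert (Hn : Rabs s * vnorm v < d).
{ apply Rle_lt_trans with (Rabs s * (vnorm v + 1)).
  - apply Rmult_le_compat_l; [apply Rabs_pos|lra].
  - apply Rmult_lt_reg_r with (/ (vnorm v + 1)); [apply Rinv_0_lt_compat; lra|].
    rewrite Rmult_assoc, Rinv_r, Rmult_1_r by lra. exact Hs. }
specialize (Hh (vscal s v) (Pscal _ _ Pv)). rewrite vnorm_scal in Hh.
specialize (Hh Hn). rewrite Ls in Hh by exact Pv.
rewrite <- vadd_assoc, <- vscal_distr_r in Hh.
replace (f (vadd x (vscal (t + s) v)) - (t + s) * L v - (f (vadd x (vscal t v)) - t * L v))
  with (f (vadd x (vscal (t + s) v)) - f (vadd x (vscal t v)) - s * L v) by ring.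
apply (Rle_trans _ _ _ Hh).
replace ((c + eps / (vnorm v + 1)) * (Rabs s * vnorm v))
  with ((c * vnorm v + eps * (vnorm v / (vnorm v + 1))) * Rabs s) by (field; lra).
apply Rmult_le_compat_r; [apply Rabs_pos|]. apply Rplus_le_compat_l.
rewrite <- (Rmult_1_r eps) at 2. apply Rmult_le_compat_l; [lra|].
apply Rmult_le_reg_r with (vnorm v + 1); [lra|]. field_simplify; lra.
Qed.

Lemma linear_on_0 P : linear_on P (fun _ : X => 0).
Proof. split; intros; ring. Qed.

Lemma whole_subspace : is_linear_subspace (@whole X).
Proof. repeat split. Qed.

Lemma approx_at_lipschitz f c :
  (forall x, approx_at whole f x (fun _ => 0) c) -> lipschitz_on whole f c.
Proof.
intros H x y _ _. rewrite <- (Rminus_0_r (f x - f y)).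
apply (approx_at_segment whole f (fun _ => 0) c y x); auto using whole_subspace, linear_on_0.
exact I.
Qed.

Lemma dual_norm_lt_bound P L eps h :
  dual_norm_lt P L eps -> P h -> Rabs (L h) <= eps * vnorm h.
Proof.
intros (c & Hc & H) Ph. apply (Rle_trans _ _ _ (H h Ph)).
apply Rmult_le_compat_r; [apply vnorm_ge0|lra].
Qed.

Lemma C1_intro P f (Df : X -> X -> R) :
  (forall y, P y -> frechet_on P f y (Df y)) ->
  (forall y, P y -> forall eps, 0 < eps -> exists delta, 0 < delta /\
     forall z, P z -> vnorm (vsub z y) < delta ->
       forall h, P h -> Rabs (Df z h - Df y h) <= eps * vnorm h) ->
  C1_on P f Df.
Proof.
intros H1 H2. split; [exact H1|]. intros y Py eps Heps.
destruct (H2 y Py (eps / 2) ltac:(lra)) as (d & Hd & H).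
exists d. split; [exact Hd|]. intros z Pz Hz. exists (eps / 2). split; [lra|].
intros h Ph. now apply H.
Qed.

Lemma C1_derivative_continuous P f (Df : X -> X -> R) y eps :
  C1_on P f Df -> P y -> 0 < eps -> exists delta, 0 < delta /\
    forall z, P z -> vnorm (vsub z y) < delta ->
      forall h, P h -> Rabs (Df z h - Df y h) <= eps * vnorm h.
Proof.
intros [_ H] Py Heps. destruct (H y Py eps Heps) as (d & Hd & Hz).
exists d. split; [exact Hd|]. intros z Pz Hn h Ph.
exact (dual_norm_lt_bound _ _ _ _ (Hz z Pz Hn) Ph).
Qed.

Lemma frechet_bound P f x L : frechet_on P f x L ->
  exists M, 0 <= M /\ dual_bound P L M.
Proof.
intros (_ & (c & Hc) & _). exists (Rabs c). split; [apply Rabs_pos|].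
intros h Ph. apply (Rle_trans _ _ _ (Hc h Ph)).
apply Rmult_le_compat_r; [apply vnorm_ge0|apply Rle_abs].
Qed.

Lemma frechet_local_lipschitz f x L : frechet_on whole f x L ->
  exists M d, 0 <= M /\ 0 < d /\
    forall z, vnorm (vsub z x) < d -> Rabs (f z - f x) <= M * vnorm (vsub z x).
Proof.
intros H. destruct (frechet_bound _ _ _ _ H) as (M & HM & HL).
destruct H as (_ & _ & H). destruct (H 1 Rlt_0_1) as (d & Hd & Hh).
exists (M + 1), d. split; [lra|]. split; [exact Hd|]. intros z Hz.
specialize (Hh (vsub z x) I Hz). rewrite vadd_vsub in Hh.
specialize (HL (vsub z x) I).
replace (f z - f x) with ((f z - f x - L (vsub z x)) + L (vsub z x)) by ring.
pose proof (Rabs_triang (f z - f x - L (vsub z x)) (L (vsub z x))). lra.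
Qed.

Lemma C1_continuous f x eps : is_C1 f -> 0 < eps ->
  exists delta, 0 < delta /\ forall z, vnorm (vsub z x) < delta -> Rabs (f z - f x) < eps.
Proof.
intros [Df [HD _]] Heps.
destruct (frechet_local_lipschitz _ _ _ (HD x I)) as (M & d & HM & Hd & H).
exists (Rmin d (eps / (M + 1))).
assert (0 < eps / (M + 1)) by (apply Rdiv_lt_0_compat; lra).
split; [now apply Rmin_pos|]. intros z Hz.
assert (Hz1 := Rlt_le_trans _ _ _ Hz (Rmin_l _ _)).
assert (Hz2 := Rlt_le_trans _ _ _ Hz (Rmin_r _ _)).
apply (Rle_lt_trans _ _ _ (H z Hz1)).
apply Rle_lt_trans with ((M + 1) * vnorm (vsub z x)).
- pose proof (vnorm_ge0 (vsub z x)). nra.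
- apply Rlt_le_trans with ((M + 1) * (eps / (M + 1))).
  + apply Rmult_lt_compat_l; lra.
  + right. field. lra.
Qed.

Lemma is_C1_affine L M p a :
  linear_on whole L -> dual_bound whole L M -> is_C1 (fun x => a + L (vsub x p)).
Proof.
intros HL HM. exists (fun _ => L). apply C1_intro.
- intros y _. split; [exact HL|]. split; [now exists M|].
  intros eps Heps. exists 1. split; [lra|]. intros h _ _.
  rewrite vsub_add. destruct HL as [La _]. rewrite La by exact I.
  replace (a + (L (vsub y p) + L h) - (a + L (vsub y p)) - L h) with 0 by ring.
  rewrite Rabs_R0. pose proof (vnorm_ge0 h). nra.
- intros y _ eps Heps. exists 1. split; [lra|]. intros z _ _ h _.
  rewrite Rminus_diag, Rabs_R0. pose proof (vnorm_ge0 h). nra.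
Qed.

Lemma is_C1_ext f g : (forall x, f x = g x) -> is_C1 f -> is_C1 g.
Proof.
intros E [Df [H1 H2]]. exists Df. split; [|exact H2].
intros y _. destruct (H1 y I) as (Hl & Hb & H). split; [exact Hl|split; [exact Hb|]].
intros eps Heps. destruct (H eps Heps) as (d & Hd & Hh). exists d. split; [exact Hd|].
intros h Ph Hn. rewrite <- !E. auto.
Qed.

Lemma is_C1_const a : is_C1 (fun _ : X => a).
Proof.
apply is_C1_ext with (fun x => a + 0); [intros; ring|].
apply (is_C1_affine (fun _ => 0) 0 vzero); [apply linear_on_0|].
intros h _. rewrite Rabs_R0. lra.
Qed.

Lemma is_C1_add f g : is_C1 f -> is_C1 g -> is_C1 (fun x => f x + g x).
Proof.
intros [Df Hf] [Dg Hg]. exists (fun x h => Df x h + Dg x h). apply C1_intro.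
- intros y _. destruct (frechet_bound _ _ _ _ (proj1 Hf y I)) as (M & _ & HM).
  destruct (frechet_bound _ _ _ _ (proj1 Hg y I)) as (N & _ & HN).
  destruct (proj1 Hf y I) as ([Fa Fs] & _ & Ff).
  destruct (proj1 Hg y I) as ([Ga Gs] & _ & Fg).
  split; [|split].
  + split; intros; [rewrite Fa, Ga by exact I|rewrite Fs, Gs by exact I]; ring.
  + exists (M + N). intros h _. specialize (HM h I). specialize (HN h I).
    pose proof (Rabs_triang (Df y h) (Dg y h)). lra.
  + intros eps Heps.
    destruct (approx_at_add _ _ _ _ _ _ _ _ (frechet_approx_at _ _ _ _ (proj1 Hf y I))
      (frechet_approx_at _ _ _ _ (proj1 Hg y I)) eps Heps) as (d & Hd & H).
    exists d. split; [exact Hd|]. intros h _ Hn. specialize (H h I Hn).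
    now replace (0 + 0 + eps) with eps in H by ring.
- intros y _ eps Heps.
  destruct (C1_derivative_continuous _ _ _ y (eps / 2) Hf I ltac:(lra)) as (d & Hd & H).
  destruct (C1_derivative_continuous _ _ _ y (eps / 2) Hg I ltac:(lra)) as (d' & Hd' & H').
  exists (Rmin d d'). split; [now apply Rmin_pos|]. intros z _ Hz h _.
  specialize (H z I (Rlt_le_trans _ _ _ Hz (Rmin_l _ _)) h I).
  specialize (H' z I (Rlt_le_trans _ _ _ Hz (Rmin_r _ _)) h I).
  replace (Df z h + Dg z h - (Df y h + Dg y h))
    with ((Df z h - Df y h) + (Dg z h - Dg y h)) by ring.
  pose proof (Rabs_triang (Df z h - Df y h) (Dg z h - Dg y h)). lra.
Qed.

(** Smoothness of [theta] enters as a quadratic Taylor bound and a Lipschitz bound on [dtheta];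
    affine functions, squares and quadratic splines satisfy both globally. *)
Lemma is_C1_comp (theta dtheta : R -> R) B f :
  0 <= B ->
  (forall t s, Rabs (theta (t + s) - theta t - dtheta t * s) <= B * s ^ 2) ->
  (forall t s, Rabs (dtheta t - dtheta s) <= B * Rabs (t - s)) ->
  is_C1 f -> is_C1 (fun x => theta (f x)).
Proof.
intros HB Htaylor Hlip Cf. destruct (Cf) as [Df Hf].
exists (fun x h => dtheta (f x) * Df x h). apply C1_intro.
- intros y _. destruct (frechet_bound _ _ _ _ (proj1 Hf y I)) as (M & HM & HD).
  destruct (proj1 Hf y I) as ([Fa Fs] & _ & Ff).
  split; [|split].
  + split; intros; [rewrite Fa by exact I|rewrite Fs by exact I]; ring.
  + exists (Rabs (dtheta (f y)) * M). intros h _. rewrite Rabs_mult, Rmult_assoc.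
    apply Rmult_le_compat_l; [apply Rabs_pos|]. now apply HD.
  + intros eps Heps. set (q := Rabs (dtheta (f y))).
    assert (Hq : 0 <= q) by apply Rabs_pos.
    (* Half of [eps] pays for the first-order error of [f] multiplied by [q] (through [e]), the
       other half for the quadratic error of [theta] (through [d']). *)
    set (e := Rmin 1 (eps / (2 * (q + 1)))).
    assert (0 < eps / (2 * (q + 1))) by (apply Rdiv_lt_0_compat; lra).
    assert (He : 0 < e) by (apply Rmin_pos; lra).
    assert (He1 : e <= 1) by apply Rmin_l.
    assert (He2 : q * e <= eps / 2).
    { apply Rle_trans with ((q + 1) * e); [nra|].
      apply Rle_trans with ((q + 1) * (eps / (2 * (q + 1)))).
      - apply Rmult_le_compat_l; [lra|]. apply Rmin_r.
      - right. field. lra. }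
    destruct (Ff e He) as (d & Hd & Hh).
    set (Q := B * (M + 1) ^ 2).
    assert (HQ : 0 <= Q) by (apply Rmult_le_pos; nra).
    set (d' := eps / (2 * (Q + 1))).
    assert (Hd' : 0 < d') by (apply Rdiv_lt_0_compat; lra).
    exists (Rmin d d'). split; [now apply Rmin_pos|]. intros h _ Hn.
    specialize (Hh h I (Rlt_le_trans _ _ _ Hn (Rmin_l _ _))).
    assert (Hn' := Rlt_le_trans _ _ _ Hn (Rmin_r _ _)).
    specialize (HD h I).
    pose proof (vnorm_ge0 h) as Hh0.
    set (s := f (vadd y h) - f y) in *.
    pose proof (Htaylor (f y) s) as HT.
    replace (f y + s) with (f (vadd y h)) in HT by (unfold s; ring).
    replace (theta (f (vadd y h)) - theta (f y) - dtheta (f y) * Df y h) with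
      ((theta (f (vadd y h)) - theta (f y) - dtheta (f y) * s)
        + dtheta (f y) * (s - Df y h)) by ring.
    eapply Rle_trans; [apply Rabs_triang|]. rewrite Rabs_mult. fold q.
    assert (Hs : Rabs s <= (M + 1) * vnorm h).
    { replace s with ((s - Df y h) + Df y h) by ring.
      eapply Rle_trans; [apply Rabs_triang|]. nra. }
    assert (Hs2 : s ^ 2 <= ((M + 1) * vnorm h) ^ 2).
    { rewrite <- (pow2_abs s). apply pow_incr. split; [apply Rabs_pos|exact Hs]. }
    assert (B * s ^ 2 <= Q * vnorm h * vnorm h).
    { unfold Q. replace (B * (M + 1) ^ 2 * vnorm h * vnorm h)
        with (B * ((M + 1) * vnorm h) ^ 2) by ring. now apply Rmult_le_compat_l. }
    assert (Q * vnorm h <= eps / 2).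
    { apply Rle_trans with ((Q + 1) * d').
      - apply Rmult_le_compat; lra.
      - right. unfold d'. field. lra. }
    assert (q * Rabs (s - Df y h) <= q * e * vnorm h).
    { rewrite Rmult_assoc. now apply Rmult_le_compat_l. }
    nra.
- intros y _ eps Heps.
  destruct (frechet_bound _ _ _ _ (proj1 Hf y I)) as (M & HM & HD).
  set (q := Rabs (dtheta (f y))). assert (Hq : 0 <= q) by apply Rabs_pos.
  (* [e] controls the change of [Df], whose factor [dtheta (f z)] is at most [B + q + 1]; [e']
     controls the change of [dtheta], whose factor [Df y] has norm at most [M]. *)
  set (e := Rmin 1 (eps / (2 * (B + q + 1)))).
  assert (0 < eps / (2 * (B + q + 1))) by (apply Rdiv_lt_0_compat; lra).
  assert (He : 0 < e) by (apply Rmin_pos; lra).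
  set (e' := Rmin 1 (eps / (2 * (B * M + 1)))).
  assert (HBM : 0 <= B * M) by now apply Rmult_le_pos.
  assert (0 < eps / (2 * (B * M + 1))) by (apply Rdiv_lt_0_compat; lra).
  assert (He' : 0 < e') by (apply Rmin_pos; lra).
  destruct (C1_derivative_continuous _ _ _ y e Hf I He) as (d & Hd & H1).
  destruct (C1_continuous f y e' Cf He') as (d' & Hd' & H2).
  exists (Rmin d d'). split; [now apply Rmin_pos|]. intros z _ Hz h _.
  specialize (H1 z I (Rlt_le_trans _ _ _ Hz (Rmin_l _ _)) h I).
  specialize (H2 z (Rlt_le_trans _ _ _ Hz (Rmin_r _ _))).
  specialize (HD h I). pose proof (vnorm_ge0 h) as Hh0.
  pose proof (Hlip (f z) (f y)) as HL.
  replace (dtheta (f z) * Df z h - dtheta (f y) * Df y h) with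
    (dtheta (f z) * (Df z h - Df y h) + (dtheta (f z) - dtheta (f y)) * Df y h) by ring.
  eapply Rle_trans; [apply Rabs_triang|]. rewrite !Rabs_mult.
  assert (e <= 1 /\ (B + q + 1) * e <= eps / 2) as [_ E1].
  { split; [apply Rmin_l|].
    apply Rle_trans with ((B + q + 1) * (eps / (2 * (B + q + 1)))).
    - apply Rmult_le_compat_l; [lra|]. apply Rmin_r.
    - right. field. lra. }
  assert (e' <= 1 /\ (B * M + 1) * e' <= eps / 2) as [E2 E3].
  { split; [apply Rmin_l|].
    apply Rle_trans with ((B * M + 1) * (eps / (2 * (B * M + 1)))).
    - apply Rmult_le_compat_l; [lra|]. apply Rmin_r.
    - right. field. lra. }
  assert (HL' : Rabs (dtheta (f z) - dtheta (f y)) <= B * e').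
  { apply (Rle_trans _ _ _ HL). apply Rmult_le_compat_l; lra. }
  assert (Hz' : Rabs (dtheta (f z)) <= B + q + 1).
  { replace (dtheta (f z)) with ((dtheta (f z) - dtheta (f y)) + dtheta (f y)) by ring.
    eapply Rle_trans; [apply Rabs_triang|]. fold q. nra. }
  assert (T1 : Rabs (dtheta (f z)) * Rabs (Df z h - Df y h) <= (B + q + 1) * (e * vnorm h)).
  { apply Rmult_le_compat; auto using Rabs_pos. }
  assert (T2 : Rabs (dtheta (f z) - dtheta (f y)) * Rabs (Df y h) <= (B * e') * (M * vnorm h)).
  { apply Rmult_le_compat; auto using Rabs_pos. }
  assert ((B + q + 1) * (e * vnorm h) <= eps / 2 * vnorm h) by nra.
  assert ((B * e') * (M * vnorm h) <= eps / 2 * vnorm h) by nra.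
  lra.
Qed.

Lemma is_C1_scal a f : is_C1 f -> is_C1 (fun x => a * f x).
Proof.
apply (is_C1_comp (fun t => a * t) (fun _ => a) 0); [lra| |].
- intros t s. replace (a * (t + s) - a * t - a * s) with 0 by ring. rewrite Rabs_R0; lra.
- intros t s. rewrite Rminus_diag, Rabs_R0. lra.
Qed.

(** Polarization reduces products to squares, which [is_C1_comp] covers. *)
Lemma is_C1_mult f g : is_C1 f -> is_C1 g -> is_C1 (fun x => f x * g x).
Proof.
intros Hf Hg.
assert (Hsq : forall u : X -> R, is_C1 u -> is_C1 (fun x => u x ^ 2)).
{ intros u. apply (is_C1_comp (fun t => t ^ 2) (fun t => 2 * t) 2); [lra| |].
  - intros t s. replace ((t + s) ^ 2 - t ^ 2 - 2 * t * s) with (s ^ 2) by ring.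
    rewrite Rabs_pos_eq; nra.
  - intros t s. rewrite <- Rmult_minus_distr_l, Rabs_mult, Rabs_pos_eq; lra. }
apply is_C1_ext with
  (fun x => / 4 * ((f x + g x) ^ 2 + -1 * (f x + -1 * g x) ^ 2)); [intros; field|].
auto 10 using is_C1_scal, is_C1_add.
Qed.

(** The derivative at [x] is taken from a model chosen for [x]. At a nearby [z], the models chosen
    for [z] and for [x] both give a derivative of [f]; these agree by uniqueness, so continuity is
    inherited from the model at [x]. *)
Lemma is_C1_local f :
  (forall x, exists d g, 0 < d /\ is_C1 g /\ forall z, vnorm (vsub z x) < d -> f z = g z) ->
  is_C1 f.
Proof.
intros H.
assert (H' : forall x, exists (Dg : X -> X -> R) d g, 0 < d /\ C1_on whole g Dg /\
  forall z, vnorm (vsub z x) < d -> f z = g z).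
{ intros x. destruct (H x) as (d & g & Hd & [Dg HD] & E). now exists Dg, d, g. }
set (D := fun x => proj1_sig (constructive_indefinite_description _ (H' x))).
assert (HD : forall x, exists d g, 0 < d /\ C1_on whole g (D x) /\
  forall z, vnorm (vsub z x) < d -> f z = g z).
{ intros x. unfold D. destruct constructive_indefinite_description as [? h]; exact h. }
assert (Hfre : forall x Dg d g z, 0 < d -> C1_on whole g Dg ->
  (forall z, vnorm (vsub z x) < d -> f z = g z) -> vnorm (vsub z x) < d ->
  frechet_on whole f z (Dg z)).
{ intros x Dg d g z Hd HC E Hz.
  destruct (proj1 HC z I) as (Hl & Hb & Hf). split; [exact Hl|split; [exact Hb|]].
  intros eps Heps. destruct (Hf eps Heps) as (d' & Hd' & Hh).
  exists (Rmin d' (d - vnorm (vsub z x))).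
  split; [apply Rmin_pos; lra|]. intros h _ Hn.
  specialize (Hh h I (Rlt_le_trans _ _ _ Hn (Rmin_l _ _))).
  assert (Hn' := Rlt_le_trans _ _ _ Hn (Rmin_r _ _)).
  rewrite !E; [exact Hh|exact Hz|].
  rewrite vsub_add. pose proof (vnorm_triangle _ (vsub z x) h). lra. }
exists (fun x => D x x). apply C1_intro.
- intros x _. destruct (HD x) as (d & g & Hd & HC & E).
  apply (Hfre x (D x) d g x); auto. now rewrite vdist_self.
- intros x _ eps Heps. destruct (HD x) as (d & g & Hd & HC & E).
  destruct (C1_derivative_continuous _ _ _ x eps HC I Heps) as (d' & Hd' & Hc).
  exists (Rmin d d'). split; [now apply Rmin_pos|]. intros z _ Hz h _.
  assert (Hz1 := Rlt_le_trans _ _ _ Hz (Rmin_l _ _)).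
  specialize (Hc z I (Rlt_le_trans _ _ _ Hz (Rmin_r _ _)) h I).
  destruct (HD z) as (d2 & g2 & Hd2 & HC2 & E2).
  assert (F1 := Hfre x _ _ _ z Hd HC E Hz1).
  assert (F2 := Hfre z _ _ _ z Hd2 HC2 E2 ltac:(now rewrite vdist_self)).
  pose proof (approx_at_unique whole f z _ _ 0 0 whole_subspace (proj1 F2) (proj1 F1)
    (frechet_approx_at _ _ _ _ F2) (frechet_approx_at _ _ _ _ F1) h I) as HU.
  replace (D z z h - D x x h) with ((D z z h - D x z h) + (D x z h - D x x h)) by ring.
  eapply Rle_trans; [apply Rabs_triang|]. lra.
Qed.

End Differentials.

(** * Smoothing Lipschitz functions *)

Lemma Rabs_combine u v a b : Rabs u <= a -> Rabs v <= b -> Rabs (u + v) <= a + b.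
Proof. intros. eapply Rle_trans; [apply Rabs_triang|]. lra. Qed.

Definition pos_sqr (t : R) : R := Rmax t 0 ^ 2.

(* The quadratic spline whose derivative is the tent function of height 2 on [0, 1]. *)
Definition step (t : R) : R := 2 * pos_sqr t + (-4 * pos_sqr (t - / 2) + 2 * pos_sqr (t - 1)).

Lemma step_0 t : t <= 0 -> step t = 0.
Proof. intros H. unfold step, pos_sqr. rewrite !Rmax_right by lra. ring. Qed.

Lemma step_1 t : 1 <= t -> step t = 1.
Proof. intros H. unfold step, pos_sqr. rewrite !Rmax_left by lra. field. Qed.

Lemma step_bounds t : 0 <= step t <= 1.
Proof. unfold step, pos_sqr, Rmax. repeat destruct Rle_dec; nra. Qed.

Lemma step_lipschitz s t : Rabs (step s - step t) <= 2 * Rabs (s - t).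
Proof.
assert (H : forall s t, s <= t -> 0 <= step t - step s <= 2 * (t - s)).
{ clear. intros s t H. unfold step, pos_sqr, Rmax. repeat destruct Rle_dec; split; nra. }
destruct (Rle_or_lt s t) as [Hst|Hst].
- rewrite !Rabs_left1; specialize (H s t Hst); lra.
- rewrite !Rabs_pos_eq; specialize (H t s); lra.
Qed.

(** A form of [property_star] that accepts any nonnegative Lipschitz bound instead of the least one,
    so it applies directly to extensions and remainders. *)
Definition smoothing_constant (Y : NormedSpace) (C : R) : Prop :=
  1 <= C /\ forall (f : Y -> R) L, 0 <= L -> lipschitz_on whole f L ->
    forall eps, 0 < eps -> exists K, is_C1 K /\ (forall x, Rabs (f x - K x) < eps) /\
      lipschitz_on whole K (C * L).

Section Smoothing.
Context {X : NormedSpace}.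
Implicit Types (f g F : X -> R) (x y z : X) (S : X -> Prop).

Lemma is_C1_step f : is_C1 f -> is_C1 (fun x => step (f x)).
Proof.
intros Hf.
assert (Hq : forall u : X -> R, is_C1 u -> is_C1 (fun x => pos_sqr (u x))).
{ intros u. apply (is_C1_comp pos_sqr (fun t => 2 * Rmax t 0) 2); [lra| |].
  - intros t s. unfold pos_sqr, Rmax. repeat destruct Rle_dec; apply Rabs_le; nra.
  - intros t s. rewrite <- Rmult_minus_distr_l, Rabs_mult, (Rabs_pos_eq 2) by lra.
    apply Rmult_le_compat_l; [lra|]. unfold Rmax, Rabs.
    repeat destruct Rle_dec; repeat destruct Rcase_abs; lra. }
unfold step.
repeat apply is_C1_add; apply is_C1_scal, Hq; [exact Hf| |];
  apply (is_C1_add _ (fun _ => _) Hf); apply is_C1_const.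
Qed.

Lemma lipschitz_weaken S f L L' : L <= L' -> lipschitz_on S f L -> lipschitz_on S f L'.
Proof.
intros HL H x y Sx Sy. apply (Rle_trans _ _ _ (H x y Sx Sy)).
apply Rmult_le_compat_r; [apply vnorm_ge0|exact HL].
Qed.

Lemma lipschitz_add S f g L L' :
  lipschitz_on S f L -> lipschitz_on S g L' -> lipschitz_on S (fun x => f x + g x) (L + L').
Proof.
intros Hf Hg x y Sx Sy. specialize (Hf x y Sx Sy). specialize (Hg x y Sx Sy).
replace (f x + g x - (f y + g y)) with ((f x - f y) + (g x - g y)) by ring.
rewrite Rmult_plus_distr_r. now apply Rabs_combine.
Qed.

Lemma lipschitz_affine L M p a :
  linear_on whole L -> dual_bound whole L M ->
  lipschitz_on whole (fun x : X => a + L (vsub x p)) M.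
Proof.
intros [La _] HM x y _ _.
assert (E : L (vsub x p) = L (vsub x y) + L (vsub y p)).
{ rewrite <- La by exact I. now rewrite vsub_chain. }
rewrite E. replace (a + (L (vsub x y) + L (vsub y p)) - (a + L (vsub y p)))
  with (L (vsub x y)) by ring. now apply HM.
Qed.

(** McShane's formula: a supremum of the downward cones [f s - L * vnorm (vsub x s)], each
    [L]-Lipschitz in [x]. *)
Lemma lipschitz_mcshane S f L : 0 <= L -> lipschitz_on S f L ->
  exists g, lipschitz_on whole g L /\ forall s, S s -> g s = f s.
Proof.
intros HL Hf.
destruct (classic (exists s, S s)) as [[s0 Hs0]|Hne].
2:{ exists (fun _ => 0). split.
    - intros x y _ _. rewrite Rminus_diag, Rabs_R0.
      apply Rmult_le_pos; [exact HL|apply vnorm_ge0].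
    - intros s Hs. exfalso. eauto. }
assert (Hsup : forall x, exists m,
  is_lub (fun r => exists s, S s /\ r = f s - L * vnorm (vsub x s)) m).
{ intros x. destruct (completeness (fun r => exists s, S s /\ r = f s - L * vnorm (vsub x s)))
    as [m Hm]; [| |now exists m].
  - exists (f s0 + L * vnorm (vsub x s0)). intros r (s & Hs & ->).
    pose proof (Hf s s0 Hs Hs0) as H. pose proof (Rle_abs (f s - f s0)).
    pose proof (vdist_triangle s x s0) as H1. rewrite (vdist_sym s x) in H1. nra.
  - now exists (f s0 - L * vnorm (vsub x s0)), s0. }
set (g := fun x => proj1_sig (constructive_indefinite_description _ (Hsup x))).
assert (Hg : forall x, is_lub (fun r => exists s, S s /\ r = f s - L * vnorm (vsub x s)) (g x)).
{ intros x. unfold g. apply proj2_sig. }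
exists g. split.
- assert (H : forall x y, g x <= g y + L * vnorm (vsub x y)).
  { intros x y. apply (Hg x). intros r (s & Hs & ->).
    assert (H : f s - L * vnorm (vsub y s) <= g y) by (apply (Hg y); eauto).
    pose proof (vdist_triangle y x s) as H1. rewrite (vdist_sym y x) in H1. nra. }
  intros x y _ _. pose proof (H x y). pose proof (H y x) as H'. rewrite (vdist_sym y x) in H'.
  apply Rabs_le. lra.
- intros s Hs. apply Rle_antisym.
  + apply (Hg s). intros r (t & Ht & ->). pose proof (Hf t s Ht Hs) as H.
    pose proof (Rle_abs (f t - f s)). rewrite (vdist_sym t s) in H. lra.
  + apply (Hg s). exists s. split; [exact Hs|]. rewrite vdist_self. ring.
Qed.

Lemma lipschitz_constant_attained f L (v : X) : v <> vzero -> lipschitz_on whole f L ->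
  exists L0, 0 <= L0 /\ is_Lip_on whole f L0.
Proof.
intros Hv HL.
assert (Hv' : 0 < vnorm v).
{ destruct (vnorm_ge0 v) as [|E]; [assumption|]. symmetry in E.
  now apply vnorm_eq0 in E. }
assert (Hpos : forall M, lipschitz_on whole f M -> 0 <= M).
{ intros M HM. specialize (HM (vadd vzero v) vzero I I). rewrite vsub_vadd in HM.
  pose proof (Rabs_pos (f (vadd vzero v) - f vzero)). nra. }
(* The infimum of the Lipschitz constants, as minus the supremum of their negatives; the nonzero [v]
   bounds them below by 0. *)
destruct (completeness (fun r => lipschitz_on whole f (- r))) as [m [Hub Hlub]].
- exists 0. intros r Hr. apply Hpos in Hr. lra.
- exists (- L). now rewrite Ropp_involutive.
- exists (- m). split; [|split].
  + assert (m <= 0); [|lra]. apply Hlub. intros r Hr. apply Hpos in Hr. lra.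
  + intros x y _ _. destruct (vnorm_ge0 (vsub x y)) as [Hd|Hd].
    * assert (H : m <= - (Rabs (f x - f y) / vnorm (vsub x y))).
      { apply Hlub. intros r Hr. specialize (Hr x y I I).
        apply Rmult_le_reg_r with (vnorm (vsub x y)); [exact Hd|].
        field_simplify; lra. }
      apply Rmult_le_compat_r with (r := vnorm (vsub x y)) in H; [|lra].
      field_simplify in H; lra.
    * symmetry in Hd. rewrite Hd. apply vdist_eq0 in Hd. subst.
      rewrite Rminus_diag, Rabs_R0. lra.
  + intros M HM. assert (- M <= m); [|lra]. apply Hub. now rewrite Ropp_involutive.
Qed.

(* In the zero space every real is a Lipschitz constant, so no least one exists and property_star says nothing; but there every function is C^1. *)
Lemma property_star_smoothing_constant : property_star X -> exists C, smoothing_constant X C.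
Proof.
intros [C0 H]. exists (Rmax 1 C0). split; [apply Rmax_l|].
intros f L HL0 HL eps Heps.
destruct (classic (exists v : X, v <> vzero)) as [[v Hv]|Htriv].
- destruct (lipschitz_constant_attained f L v Hv HL) as (L0 & HL00 & Hf).
  destruct (H f L0 Hf eps Heps) as (K & HK & Happ & HLip).
  exists K. split; [exact HK|split; [exact Happ|]].
  apply (lipschitz_weaken _ _ (C0 * L0)); [|exact HLip].
  destruct Hf as [_ Hmin]. specialize (Hmin L HL).
  pose proof (Rmax_l 1 C0). pose proof (Rmax_r 1 C0).
  apply Rle_trans with (Rmax 1 C0 * L0); nra.
- assert (Hall : forall x : X, x = vzero).
  { intros x. apply NNPP. intros Hx. eauto. }
  exists f. split; [|split].
  + apply is_C1_ext with (fun _ => f vzero); [|apply is_C1_const].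
    intros x. now rewrite (Hall x).
  + intros x. now rewrite Rminus_diag, Rabs_R0.
  + apply (lipschitz_weaken _ _ L); [|exact HL]. pose proof (Rmax_l 1 C0). nra.
Qed.

Variable C : R.
Hypothesis HC : smoothing_constant X C.

(** The values 3/2 on [S] and -1/2 on [S'] are [2 / rho]-Lipschitz. After extension and smoothing
    within 1/2 they stay at least 1 and at most 0, where [step] is constant. The slope is the factor
    2 of [step] times [C * (2 / rho)]. *)
Lemma smooth_urysohn S (S' : X -> Prop) rho : 0 < rho ->
  (forall x y, S x -> S' y -> rho <= vnorm (vsub x y)) ->
  exists phi : X -> R, is_C1 phi /\ (forall x, 0 <= phi x <= 1) /\
    (forall x, S x -> phi x = 1) /\ (forall x, S' x -> phi x = 0) /\
    lipschitz_on whole phi (4 * C / rho).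
Proof.
intros Hrho Hsep. destruct HC as [HC1 HCs].
set (a := fun x => if excluded_middle_informative (S x) then 3 / 2 else - (1 / 2)).
assert (Ha : lipschitz_on (fun x => S x \/ S' x) a (2 / rho)).
{ assert (Hpos : forall x y : X, 0 <= 2 / rho * vnorm (vsub x y)).
  { intros x y. apply Rmult_le_pos; [|apply vnorm_ge0].
    apply Rlt_le, Rdiv_lt_0_compat; lra. }
  assert (Hfar : forall x y, S x -> S' y -> 2 <= 2 / rho * vnorm (vsub x y)).
  { intros x y Sx Sy. apply Rle_trans with (2 / rho * rho); [right; field; lra|].
    apply Rmult_le_compat_l; [apply Rlt_le, Rdiv_lt_0_compat; lra|auto]. }
  intros x y Hx Hy. specialize (Hpos x y). unfold a.
  destruct excluded_middle_informative as [Sx|nSx];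
  destruct excluded_middle_informative as [Sy|nSy].
  - rewrite Rminus_diag, Rabs_R0. exact Hpos.
  - destruct Hy as [|Sy']; [contradiction|]. specialize (Hfar x y Sx Sy').
    rewrite Rabs_pos_eq; lra.
  - destruct Hx as [|Sx']; [contradiction|]. specialize (Hfar y x Sy Sx').
    rewrite vdist_sym in Hfar. rewrite Rabs_left; lra.
  - rewrite Rminus_diag, Rabs_R0. exact Hpos. }
assert (Hrho2 : 0 <= 2 / rho) by (apply Rlt_le, Rdiv_lt_0_compat; lra).
destruct (lipschitz_mcshane _ _ _ Hrho2 Ha) as (b & Hb & Eb).
destruct (HCs b (2 / rho) Hrho2 Hb (1 / 2) ltac:(lra)) as (K & HK & HKb & HKL).
exists (fun x => step (K x)). split; [now apply is_C1_step|].
split; [intros; apply step_bounds|]. split; [|split].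
- intros x Sx. apply step_1. specialize (HKb x). rewrite Eb in HKb by auto.
  unfold a in HKb. destruct excluded_middle_informative; [|contradiction].
  apply Rabs_def2 in HKb. lra.
- intros x Sx. apply step_0. specialize (HKb x). rewrite Eb in HKb by auto.
  unfold a in HKb. destruct excluded_middle_informative as [Sx'|_].
  + specialize (Hsep x x Sx' Sx). rewrite vdist_self in Hsep. lra.
  + apply Rabs_def2 in HKb. lra.
- intros x y _ _. eapply Rle_trans; [apply step_lipschitz|].
  specialize (HKL x y I I). replace (4 * C / rho) with (2 * (C * (2 / rho))) by (field; lra).
  lra.
Qed.

(* K1 smooths an eta-Lipschitz extension of F from S, K2 smooths F, and phi = 1 near S switches between them within distance 2 rho of S. There K1 and K2 are O(L rho)-close, which compensates the O(1/rho) slope of phi. *)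
Lemma smoothing_with_small_slope F S L eta eps :
  0 < L -> 0 <= eta <= L -> 0 < eps ->
  lipschitz_on whole F L -> lipschitz_on S F eta ->
  exists G, is_C1 G /\ (forall x, Rabs (F x - G x) < eps) /\
    lipschitz_on whole G (25 * C * L) /\
    forall s, S s -> approx_at whole G s (fun _ => 0) (C * eta).
Proof.
intros HL Heta Heps HF HFS.
assert (HC1 : 1 <= C) by apply HC.
destruct (lipschitz_mcshane S F eta (proj1 Heta) HFS) as (F1 & HF1 & E1).
(* Within [2 * rho] of [S], [F1] and [F] differ by at most [(eta + L) * 2 * rho <= 4 * (L * rho)].
   One smoothing error makes this 5, two make it 6, times [L * rho = eps / 6]. *)
set (rho := eps / (6 * L)).
assert (Hrho : 0 < rho) by (apply Rdiv_lt_0_compat; lra).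
assert (HLrho : 6 * (L * rho) = eps) by (unfold rho; field; lra).
assert (Hk : 0 < L * rho) by nra.
destruct (proj2 HC F1 eta (proj1 Heta) HF1 _ Hk) as (K1 & CK1 & HK1 & LK1).
destruct (proj2 HC F L (Rlt_le _ _ HL) HF _ Hk) as (K2 & CK2 & HK2 & LK2).
destruct (smooth_urysohn (fun x => exists s, S s /\ vnorm (vsub x s) < rho)
  (fun x => forall s, S s -> 2 * rho <= vnorm (vsub x s)) rho Hrho)
  as (phi & Cphi & Bphi & phi1 & phi0 & Lphi).
{ intros x y (s & Ss & Hxs) Hy. specialize (Hy s Ss).
  pose proof (vdist_triangle y x s). rewrite (vdist_sym y x) in *. lra. }
assert (Hnear : forall x, phi x <> 0 -> Rabs (F1 x - F x) <= 4 * (L * rho)).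
{ intros x Hx. assert (exists s, S s /\ vnorm (vsub x s) < 2 * rho) as (s & Ss & Hs).
  { apply NNPP. intros Hn. apply Hx, phi0. intros s Ss. apply Rnot_lt_le. eauto. }
  replace (F1 x - F x) with ((F1 x - F1 s) + - (F x - F s)) by (rewrite (E1 s Ss); ring).
  specialize (HF1 x s I I). specialize (HF x s I I).
  pose proof (vnorm_ge0 (vsub x s)).
  apply Rle_trans with (eta * vnorm (vsub x s) + L * vnorm (vsub x s)).
  - apply Rabs_combine; [exact HF1|]. now rewrite Rabs_Ropp.
  - nra. }
exists (fun x => K2 x + phi x * (K1 x + -1 * K2 x)).
split; [auto 10 using is_C1_add, is_C1_mult, is_C1_scal|]. split; [|split].
- intros x. specialize (HK1 x). specialize (HK2 x). specialize (Bphi x).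
  replace (F x - (K2 x + phi x * (K1 x + -1 * K2 x)))
    with ((1 - phi x) * (F x - K2 x) + phi x * (F x - K1 x)) by ring.
  eapply Rle_lt_trans; [apply Rabs_triang|].
  rewrite !Rabs_mult, (Rabs_pos_eq (phi x)), (Rabs_pos_eq (1 - phi x)) by lra.
  destruct (Req_dec (phi x) 0) as [E|Hx]; [rewrite E; nra|].
  specialize (Hnear x Hx).
  assert (Rabs (F x - K1 x) <= 5 * (L * rho)).
  { replace (F x - K1 x) with (- (F1 x - F x) + (F1 x - K1 x)) by ring.
    apply Rle_trans with (4 * (L * rho) + L * rho); [|lra].
    apply Rabs_combine; [now rewrite Rabs_Ropp|lra]. }
  apply Rle_lt_trans with ((1 - phi x) * (5 * (L * rho)) + phi x * (5 * (L * rho))); nra.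
- assert (Hdiff : forall y, phi y <> 0 -> Rabs (K1 y - K2 y) <= 6 * (L * rho)).
  { intros y Hy. specialize (Hnear y Hy). specialize (HK1 y). specialize (HK2 y).
    replace (K1 y - K2 y) with ((- (F1 y - K1 y) + (F1 y - F y)) + (F y - K2 y)) by ring.
    apply Rle_trans with ((L * rho + 4 * (L * rho)) + L * rho); [|lra].
    repeat apply Rabs_combine; try lra. rewrite Rabs_Ropp. lra. }
  (* The increment is split so that the slope of [phi] multiplies [K1 - K2] at [y] alone; one point
     with [phi] nonzero thus suffices. If [phi] vanishes at both, only [K2] is seen. *)
  assert (Hone : forall x y, phi y <> 0 ->
    Rabs (K2 x + phi x * (K1 x + -1 * K2 x) - (K2 y + phi y * (K1 y + -1 * K2 y)))
      <= 25 * C * L * vnorm (vsub x y)).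
  { intros x y Hy. specialize (Hdiff y Hy). specialize (Bphi x).
    specialize (LK1 x y I I). specialize (LK2 x y I I). specialize (Lphi x y I I).
    pose proof (vnorm_ge0 (vsub x y)) as Hd.
    replace (K2 x + phi x * (K1 x + -1 * K2 x) - (K2 y + phi y * (K1 y + -1 * K2 y)))
      with ((phi x * (K1 x - K1 y) + (1 - phi x) * (K2 x - K2 y))
        + (phi x - phi y) * (K1 y - K2 y)) by ring.
    (* The convex part costs [C * L], the slope of [phi] costs [4 * C / rho * (6 * (L * rho)) = 24 *
       C * L]. *)
    apply Rle_trans with ((phi x * (C * L * vnorm (vsub x y))
      + (1 - phi x) * (C * L * vnorm (vsub x y)))
      + 4 * C / rho * vnorm (vsub x y) * (6 * (L * rho))).
    2:{ right. field. lra. }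
    apply Rabs_combine; [apply Rabs_combine|]; rewrite Rabs_mult.
    - rewrite Rabs_pos_eq by lra. apply Rmult_le_compat_l; [lra|].
      apply (Rle_trans _ _ _ LK1). apply Rmult_le_compat_r; [exact Hd|]. nra.
    - rewrite Rabs_pos_eq by lra. apply Rmult_le_compat_l; [lra|]. exact LK2.
    - apply Rmult_le_compat; auto using Rabs_pos. }
  intros x y _ _. destruct (Req_dec (phi y) 0) as [Ey|Hy]; [|now apply Hone].
  destruct (Req_dec (phi x) 0) as [Ex|Hx].
  + rewrite Ex, Ey, !Rmult_0_l, !Rplus_0_r.
    apply (Rle_trans _ _ _ (LK2 x y I I)).
    apply Rmult_le_compat_r; [apply vnorm_ge0|]. nra.
  + rewrite Rabs_minus_sym, vdist_sym. now apply Hone.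
- intros s Ss e He.
  destruct (lipschitz_approx_at _ _ s LK1 e He) as (d & Hd & H).
  exists (Rmin d rho). split; [now apply Rmin_pos|]. intros h _ Hn.
  specialize (H h I (Rlt_le_trans _ _ _ Hn (Rmin_l _ _))).
  rewrite !phi1.
  + replace (K2 (vadd s h) + 1 * (K1 (vadd s h) + -1 * K2 (vadd s h))
      - (K2 s + 1 * (K1 s + -1 * K2 s)) - 0) with (K1 (vadd s h) - K1 s - 0) by ring.
    exact H.
  + exists s. split; [exact Ss|]. now rewrite vdist_self.
  + exists s. split; [exact Ss|]. rewrite vsub_vadd.
    apply (Rlt_le_trans _ _ _ Hn), Rmin_r.
Qed.

End Smoothing.

(** * Partitions of unity *)

(** [p c] is the least [q] related to [c] in a well-order. If [p c] also serves [d] and [p d] serves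
    [c], each is at most the other. *)
Lemma minimal_choice (T : Type) (U : T -> T -> Prop) :
  (forall c, U c c) ->
  exists p : T -> T, (forall c, U (p c) c) /\
    forall c d, U (p c) d -> U (p d) c -> p c = p d.
Proof.
intros Urefl. destruct (exists_well_order T) as (le & anti & wf).
assert (H : forall c, exists q, U q c /\ forall q', U q' c -> le q q').
{ intros c. apply wf. now exists c. }
destruct (choice _ H) as [p Hp]. exists p.
split; [intros c; apply Hp|].
intros c d Hcd Hdc. apply anti; now apply Hp.
Qed.

Lemma sum_f_R0_tail_0 (u : nat -> R) N M :
  (forall j, (N < j)%nat -> u j = 0) -> (forall j, (M < j)%nat -> u j = 0) ->
  sum_f_R0 u N = sum_f_R0 u M.
Proof.
assert (H : forall N k, (forall j, (N < j)%nat -> u j = 0) ->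
  sum_f_R0 u (N + k) = sum_f_R0 u N).
{ clear. intros N k H. induction k as [|k IH]; [now rewrite Nat.add_0_r|].
  rewrite Nat.add_succ_r. simpl. rewrite IH, H by lia. ring. }
intros HN HM. destruct (Nat.le_ge_cases N M).
- replace M with (N + (M - N))%nat by lia. now rewrite H.
- replace N with (M + (N - M))%nat by lia. now rewrite H.
Qed.

Section Gluing.
Context {X : NormedSpace}.
Implicit Types (x y z c : X).

Lemma lipschitz_mult_unit (f g : X -> R) L L' :
  (forall x, 0 <= f x <= 1) -> (forall x, 0 <= g x <= 1) ->
  lipschitz_on whole f L -> lipschitz_on whole g L' ->
  lipschitz_on whole (fun x => f x * g x) (L + L').
Proof.
intros Bf Bg Hf Hg x y _ _. specialize (Hf x y I I). specialize (Hg x y I I).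
replace (f x * g x - f y * g y) with ((f x - f y) * g x + (g x - g y) * f y) by ring.
rewrite Rmult_plus_distr_r. specialize (Bf y). specialize (Bg x).
pose proof (Rabs_pos (f x - f y)). pose proof (Rabs_pos (g x - g y)).
apply Rabs_combine; rewrite Rabs_mult.
- rewrite (Rabs_pos_eq (g x)) by lra. nra.
- rewrite (Rabs_pos_eq (f y)) by lra. nra.
Qed.

(** What the first [n] functions leave of 1. The parts [remainder phi n x * phi n x] taken in turn
    telescope, and nothing is left once some [phi n x] is 1. *)
Fixpoint remainder (phi : nat -> X -> R) (n : nat) (x : X) : R :=
  match n with
  | O => 1
  | S n => remainder phi n x * (1 - phi n x)
  end.

Lemma sum_remainder phi N x :
  sum_f_R0 (fun j => remainder phi j x * phi j x) N = 1 - remainder phi (S N) x.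
Proof. induction N as [|N IH]; [simpl; ring|]. simpl in *. rewrite IH. ring. Qed.

Lemma remainder_0 phi n m x : (n < m)%nat -> phi n x = 1 -> remainder phi m x = 0.
Proof.
intros Hnm H. induction Hnm as [|m Hnm IH]; simpl; [rewrite H|rewrite IH]; ring.
Qed.

Lemma remainder_bounds phi n x : (forall n, 0 <= phi n x <= 1) -> 0 <= remainder phi n x <= 1.
Proof.
intros H. induction n as [|n IH]; simpl; [lra|]. specialize (H n). nra.
Qed.

Lemma is_C1_remainder phi n : (forall n, is_C1 (phi n)) -> is_C1 (remainder phi n).
Proof.
intros H. induction n as [|n IH]; simpl; [apply is_C1_const|].
apply is_C1_mult; [exact IH|].
apply is_C1_ext with (fun x => 1 + -1 * phi n x); [intros; ring|].
auto using is_C1_add, is_C1_const, is_C1_scal.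
Qed.

Lemma lipschitz_remainder phi n :
  (forall n x, 0 <= phi n x <= 1) ->
  (forall n, exists l, 0 <= l /\ lipschitz_on whole (phi n) l) ->
  exists l, 0 <= l /\ lipschitz_on whole (remainder phi n) l.
Proof.
intros B H. induction n as [|n [l [Hl IH]]].
- exists 0. split; [lra|]. intros x y _ _. simpl. rewrite Rminus_diag, Rabs_R0. lra.
- destruct (H n) as (l' & Hl' & H'). exists (l + l'). split; [lra|].
  apply lipschitz_mult_unit; [intros; now apply remainder_bounds| |exact IH|].
  + intros x. specialize (B n x). lra.
  + intros x y Px Py. specialize (H' x y Px Py).
    replace (1 - phi n x - (1 - phi n y)) with (- (phi n x - phi n y)) by ring.
    now rewrite Rabs_Ropp.
Qed.

(* For each n the points c well inside their first ball B(p c, r (p c)) split, according to the value of p c, into clusters that are 3 s_n apart (M. E. Rudin's proof of Stone's theorem); w n is supported near these clusters, and o n names the ball of the nearby cluster. *)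
Lemma smooth_partition C (r : X -> R) :
  smoothing_constant X C -> (forall p, 0 < r p) ->
  exists (w : nat -> X -> R) (l : nat -> R) (o : nat -> X -> X),
    (forall n, is_C1 (w n)) /\ (forall n x, 0 <= w n x) /\
    (forall n, 0 <= l n /\ lipschitz_on whole (w n) (l n)) /\
    (forall x, exists N d, 0 < d /\ forall z, vnorm (vsub z x) < d ->
       sum_f_R0 (fun j => w j z) N = 1 /\ forall j, (N < j)%nat -> w j z = 0) /\
    (forall n x, exists d, 0 < d /\
       ((forall z, vnorm (vsub z x) < d -> w n z = 0) \/
        exists q, forall z, vnorm (vsub z x) < d -> o n z = q /\ vnorm (vsub z q) < r q)).
Proof.
intros HC Hr.
destruct (minimal_choice X (fun q c => vnorm (vsub c q) < r q)) as (p & Hp & Hpmin).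
{ intros c. now rewrite vdist_self. }
set (s := fun n => / (INR n + 1)).
assert (Hs : forall n, 0 < s n).
{ intros n. apply Rinv_0_lt_compat. pose proof (pos_INR n). lra. }
(* The points with margin [3 * s n] inside their chosen ball. Two of them closer than this lie in
   each other's balls, so their centres agree by [minimal_choice]. *)
set (A := fun n c => vnorm (vsub c (p c)) + 3 * s n <= r (p c)).
assert (Hsep : forall n c d, A n c -> A n d -> vnorm (vsub c d) < 3 * s n -> p c = p d).
{ intros n c d Ac Ad Hcd. unfold A in *. apply Hpmin.
  - pose proof (vdist_triangle d c (p c)). rewrite (vdist_sym d c) in *. lra.
  - pose proof (vdist_triangle c d (p d)). lra. }
assert (Hphi : forall n, exists phi : X -> R, is_C1 phi /\ (forall x, 0 <= phi x <= 1) /\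
    (forall x, (exists c, A n c /\ vnorm (vsub x c) < s n) -> phi x = 1) /\
    (forall x, (forall c, A n c -> 4 / 3 * s n <= vnorm (vsub x c)) -> phi x = 0) /\
    lipschitz_on whole phi (4 * C / (s n / 3))).
{ intros n. specialize (Hs n). apply (smooth_urysohn C HC); [lra|].
  intros x y (c & Ac & Hx) Hy. specialize (Hy c Ac).
  pose proof (vdist_triangle y x c). rewrite (vdist_sym y x) in *. lra. }
destruct (choice _ Hphi) as [phi Hphi']. clear Hphi.
assert (HC1 : 1 <= C) by apply HC.
assert (Cphi : forall n, is_C1 (phi n)) by apply Hphi'.
assert (Bphi : forall n x, 0 <= phi n x <= 1) by apply Hphi'.
assert (Lphi : forall n, exists l, 0 <= l /\ lipschitz_on whole (phi n) l).
{ intros n. specialize (Hs n). exists (4 * C / (s n / 3)). split; [|apply Hphi'].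
  apply Rlt_le, Rdiv_lt_0_compat; lra. }
assert (Hl : forall n, exists l, 0 <= l /\
  lipschitz_on whole (fun x => remainder phi n x * phi n x) l).
{ intros n. destruct (lipschitz_remainder phi n Bphi Lphi) as (l & Hl & HL).
  destruct (Lphi n) as (l' & Hl' & HL'). exists (l + l'). split; [lra|].
  apply lipschitz_mult_unit; auto. intros x. now apply remainder_bounds. }
destruct (choice _ Hl) as [l Hl']. clear Hl.
(* Two points of [A n] within [3 / 2 * s n] of [x] are less than [3 * s n] apart, so at most one [q]
   qualifies. The default of [epsilon] occurs only where [phi n] vanishes. *)
set (cluster := fun n x q => exists c, A n c /\ vnorm (vsub x c) < 3 / 2 * s n /\ q = p c).
exists (fun n x => remainder phi n x * phi n x), l,
  (fun n x => epsilon (inhabits x) (cluster n x)).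
split; [|split; [|split; [|split]]].
- intros n. apply is_C1_mult; [now apply is_C1_remainder|auto].
- intros n x. apply Rmult_le_pos; [now apply remainder_bounds|apply Bphi].
- exact Hl'.
- intros x. specialize (Hp x).
  (* [N] is so large that the margin of [x] in its ball exceeds [3 * s N]. Then [phi N] is 1 within
     [s N] of [x], and no later function has any mass there. *)
  destruct (archimed_cor1 ((r (p x) - vnorm (vsub x (p x))) / 3)) as (N & HN & HN0); [lra|].
  assert (Ax : A N x).
  { unfold A. assert (s N < / INR N); [|lra].
    apply Rinv_lt_contravar; [|lra]. apply lt_0_INR in HN0. nra. }
  exists N, (s N). split; [auto|]. intros z Hz.
  assert (phi1 : phi N z = 1) by (apply Hphi'; eauto).
  split.
  + rewrite sum_remainder, (remainder_0 _ N); auto. ring.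
  + intros j Hj. rewrite (remainder_0 _ N); auto. ring.
(* The threshold 17/12 is midway between 4/3, beyond which [phi n] vanishes, and 3/2, the reach of
   [cluster]; moving by [s n / 12] crosses neither. *)
- intros n x. specialize (Hs n). exists (s n / 12). split; [lra|].
  destruct (classic (exists c, A n c /\ vnorm (vsub x c) < 17 / 12 * s n))
    as [(c & Ac & Hc)|Hn].
  + right. exists (p c). intros z Hz.
    assert (Hzc : vnorm (vsub z c) < 3 / 2 * s n).
    { pose proof (vdist_triangle z x c). lra. }
    split.
    * destruct (epsilon_spec (inhabits z) (cluster n z)) as (c' & Ac' & Hc' & ->).
      { exists (p c), c. auto. }
      apply (Hsep n); auto. pose proof (vdist_triangle c' z c).
      rewrite (vdist_sym c' z) in *. lra.
    * unfold A in Ac. pose proof (vdist_triangle z c (p c)). lra.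
  + left. intros z Hz. destruct (Hphi' n) as (_ & _ & _ & phi0 & _).
    rewrite phi0; [ring|]. intros c Ac. apply Rnot_lt_le. intros Hzc. apply Hn.
    exists c. split; [exact Ac|]. pose proof (vdist_triangle x z c).
    rewrite (vdist_sym x z) in *. lra.
Qed.

Lemma is_C1_sum (u : nat -> X -> R) N :
  (forall j, is_C1 (u j)) -> is_C1 (fun x => sum_f_R0 (fun j => u j x) N).
Proof.
intros H. induction N as [|N IH]; simpl; [apply H|]. now apply is_C1_add.
Qed.

(** Strictness survives because finitely many terms have a common bound [e < eps]; a term of weight
    0 accepts any [e], here [eps - 1]. *)
Lemma convex_combination_lt (w H : nat -> R) N v eps :
  (forall j, 0 <= w j) -> (forall j, w j <> 0 -> Rabs (H j - v) < eps) ->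
  sum_f_R0 w N = 1 -> Rabs (sum_f_R0 (fun j => w j * H j) N - v) < eps.
Proof.
intros Hw HH H1.
assert (exists e, e < eps /\
  Rabs (sum_f_R0 (fun j => w j * (H j - v)) N) <= e * sum_f_R0 w N) as (e & He & Hb).
{ assert (Hj : forall j, exists e, e < eps /\ Rabs (w j * (H j - v)) <= e * w j).
  { intros j. destruct (Req_dec (w j) 0) as [E|E].
    - exists (eps - 1). rewrite E, Rmult_0_l, Rabs_R0. lra.
    - exists (Rabs (H j - v)). split; [auto|]. rewrite Rabs_mult, Rabs_pos_eq; auto.
      lra. }
  clear H1. induction N as [|N [e [He IH]]]; [apply Hj|]. simpl.
  destruct (Hj (S N)) as (e' & He' & H').
  exists (Rmax e e'). split; [now apply Rmax_lub_lt|].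
  rewrite Rmult_plus_distr_l. apply Rabs_combine.
  - apply (Rle_trans _ _ _ IH). apply Rmult_le_compat_r; [now apply cond_pos_sum|].
    apply Rmax_l.
  - apply (Rle_trans _ _ _ H'). apply Rmult_le_compat_r; [auto|]. apply Rmax_r. }
replace (sum_f_R0 (fun j => w j * H j) N - v)
  with (sum_f_R0 (fun j => w j * (H j - v)) N).
- rewrite H1 in Hb. lra.
- apply eq_trans with (sum_f_R0 (fun j => w j * H j) N - v * sum_f_R0 w N);
    [|rewrite H1; ring].
  rewrite scal_sum, <- minus_sum. apply sum_eq. intros; ring.
Qed.

(** [Good p r delta K] abstracts a local model [K] on the ball of radius [r] about [p] with accuracy
    [delta]. The radius comes before [delta]: the radii determine the partition, whose Lipschitz
    constants then dictate the accuracies. The last clause is used on the subspace for (ii) and on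
    [whole] for (iii). *)
Lemma glue C (Good : X -> R -> R -> (X -> R) -> Prop) tau :
  smoothing_constant X C -> 0 < tau ->
  (forall p, exists r, 0 < r /\ forall delta, 0 < delta ->
    exists K, is_C1 K /\ Good p r delta K) ->
  exists G, is_C1 G /\
    (forall x v eps,
      (forall p r delta K, 0 < delta <= tau -> vnorm (vsub x p) < r -> Good p r delta K ->
        Rabs (K x - v) < eps) ->
      Rabs (G x - v) < eps) /\
    (forall (P : X -> Prop) x v L (c : R),
      (forall p r delta K, 0 < delta <= tau -> vnorm (vsub x p) < r -> Good p r delta K ->
        Rabs (K x - v) <= delta /\ approx_at P K x L c) ->
      approx_at P G x L (c + tau)).
Proof.
intros HC Htau Hloc. destruct (choice _ Hloc) as [r Hr']. clear Hloc.
assert (Hr : forall p, 0 < r p) by apply Hr'.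
assert (HKex : forall pd : X * R, exists K : X -> R,
  0 < snd pd -> is_C1 K /\ Good (fst pd) (r (fst pd)) (snd pd) K).
{ intros [p d]; simpl. destruct (Rlt_or_le 0 d) as [Hd|Hd].
  - destruct (proj2 (Hr' p) d Hd) as [K HK]. now exists K.
  - exists (fun _ => 0). intros. lra. }
destruct (choice _ HKex) as [K' HK']. clear HKex.
set (K := fun p d => K' (p, d)).
assert (HK : forall p d, 0 < d -> is_C1 (K p d)).
{ intros p d Hd. now apply (HK' (p, d)). }
assert (HGood : forall p d, 0 < d -> Good p (r p) d (K p d)).
{ intros p d Hd. now apply (HK' (p, d)). }
clearbody K. clear HK' K' Hr'.
destruct (smooth_partition C r HC Hr) as (w & l & o & Cw & Pw & Lw & Fw & Ow).
(* The accuracy offsets the slope [l n] of [w n]: the products [l n * delta n] sum to at most [tau].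
   The 1 in the denominator also gives [delta n <= tau]. *)
set (delta := fun n => tau * (/ 2) ^ S n / (1 + l n)).
assert (Hpow : forall n, 0 < (/ 2) ^ S n <= 1).
{ intros n. split; [apply pow_lt; lra|]. rewrite <- (pow1 (S n)). apply pow_incr. lra. }
assert (Hdelta : forall n, 0 < delta n <= tau /\ l n * delta n <= tau * (/ 2) ^ S n).
{ intros n. destruct (Lw n) as [Hl _]. specialize (Hpow n).
  assert (E : (1 + l n) * delta n = tau * (/ 2) ^ S n) by (unfold delta; field; lra).
  assert (0 < tau * (/ 2) ^ S n <= tau) by nra.
  assert (0 < delta n) by (apply Rdiv_lt_0_compat; lra). nra. }
set (H := fun n z => K (o n z) (delta n) z).
destruct (choice _ Fw) as [N HN].
set (G := fun x => sum_f_R0 (fun j => w j x * H j x) (N x)).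
assert (HG : forall x, exists d, 0 < d /\ forall z, vnorm (vsub z x) < d ->
  G z = sum_f_R0 (fun j => w j z * H j z) (N x) /\ sum_f_R0 (fun j => w j z) (N x) = 1).
{ intros x. destruct (HN x) as (d & Hd & Hz). exists d. split; [exact Hd|].
  intros z Hzx. destruct (Hz z Hzx) as [H1 H2]. split; [|exact H1].
  apply sum_f_R0_tail_0; intros j Hj.
  - destruct (HN z) as (d' & Hd' & Hz'). rewrite (proj2 (Hz' z ltac:(now rewrite vdist_self))); auto.
    ring.
  - rewrite H2 by exact Hj. ring. }
exists G. split; [|split].
- apply is_C1_local. intros x. destruct (HG x) as (d & Hd & Hz).
  exists d, (fun z => sum_f_R0 (fun j => w j z * H j z) (N x)).
  split; [exact Hd|]. split; [|intros z Hzx; now apply Hz].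
  apply is_C1_sum with (u := fun j z => w j z * H j z). intros j.
  (* [H j] may jump with [o j], but near each point either [w j] vanishes or [o j] is constant. *)
  apply is_C1_local. intros y.
  destruct (Ow j y) as (d' & Hd' & [H0|[q Hq]]).
  + exists d', (fun _ => 0). split; [exact Hd'|]. split; [apply is_C1_const|].
    intros z Hzy. rewrite H0 by exact Hzy. ring.
  + exists d', (fun z => w j z * K q (delta j) z). split; [exact Hd'|].
    split; [apply is_C1_mult; [apply Cw|apply HK, Hdelta]|].
    intros z Hzy. unfold H. destruct (Hq z Hzy) as [-> _]. reflexivity.
- intros x v eps Hx. destruct (HG x) as (d & Hd & Hz).
  destruct (Hz x ltac:(now rewrite vdist_self)) as [-> H1].
  apply convex_combination_lt; [auto| |exact H1].
  intros j Hj. apply (Hx (o j x) (r (o j x)) (delta j) (K (o j x) (delta j)));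
    [apply Hdelta| |apply HGood, Hdelta].
  destruct (Ow j x) as (d' & Hd' & [H0|[q Hq]]).
  + exfalso. apply Hj, H0. now rewrite vdist_self.
  + destruct (Hq x ltac:(now rewrite vdist_self)) as [-> Hlt]. exact Hlt.
- intros P x v L c Hx e He.
  (* One term of the product-rule identity: the increment of the model is weighted by [w j] at
     [vadd x h], and the increment of [w j] multiplies a model error of at most [delta j]. *)
  assert (Hterm : forall j, exists d, 0 < d /\ forall h, P h -> vnorm h < d ->
    Rabs (w j (vadd x h) * (H j (vadd x h) - v - L h) - w j x * (H j x - v))
      <= (w j (vadd x h) * (c + e) + tau * (/ 2) ^ S j) * vnorm h).
  { intros j. destruct (Ow j x) as (d & Hd & [H0|[q Hq]]).
    - exists d. split; [exact Hd|]. intros h Ph Hn.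
      rewrite !H0; [|now rewrite vdist_self|now rewrite vsub_vadd].
      rewrite !Rmult_0_l, Rminus_diag, Rabs_R0, Rplus_0_l.
      apply Rmult_le_pos; [|apply vnorm_ge0]. specialize (Hpow j). nra.
    - destruct (Hq x ltac:(now rewrite vdist_self)) as [Ex Hlt].
      destruct (Hdelta j) as [Hdj Hldj].
      destruct (Hx q (r q) (delta j) _ Hdj Hlt (HGood _ _ (proj1 Hdj))) as [Hv Happ].
      destruct (Happ e He) as (d' & Hd' & Hh).
      exists (Rmin d d'). split; [now apply Rmin_pos|]. intros h Ph Hn.
      specialize (Hh h Ph (Rlt_le_trans _ _ _ Hn (Rmin_r _ _))).
      assert (Hn' := Rlt_le_trans _ _ _ Hn (Rmin_l _ _)).
      destruct (Hq (vadd x h) ltac:(now rewrite vsub_vadd)) as [Eh _].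
      unfold H. rewrite Ex, Eh.
      replace (w j (vadd x h) * (K q (delta j) (vadd x h) - v - L h)
          - w j x * (K q (delta j) x - v))
        with (w j (vadd x h) * (K q (delta j) (vadd x h) - K q (delta j) x - L h)
          + (w j (vadd x h) - w j x) * (K q (delta j) x - v)) by ring.
      rewrite Rmult_plus_distr_r. apply Rabs_combine; rewrite Rabs_mult.
      + rewrite Rabs_pos_eq by auto. rewrite Rmult_assoc.
        apply Rmult_le_compat_l; auto.
      + destruct (Lw j) as [Hl HL]. specialize (HL (vadd x h) x I I).
        rewrite vsub_vadd in HL. pose proof (vnorm_ge0 h).
        apply Rle_trans with ((l j * vnorm h) * delta j).
        * apply Rmult_le_compat; auto using Rabs_pos.
        * nra. }
  assert (Hsum : forall n, exists d, 0 < d /\ forall h, P h -> vnorm h < d ->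
    Rabs (sum_f_R0 (fun j => w j (vadd x h) * (H j (vadd x h) - v - L h)
        - w j x * (H j x - v)) n)
      (* [1 - (/ 2) ^ S n] is the partial sum of the geometric series. *)
      <= (sum_f_R0 (fun j => w j (vadd x h)) n * (c + e) + tau * (1 - (/ 2) ^ S n)) * vnorm h).
  { induction n as [|n (d & Hd & IH)].
    - destruct (Hterm 0%nat) as (d & Hd & Hh). exists d. split; [exact Hd|].
      intros h Ph Hn. simpl. specialize (Hh h Ph Hn). simpl in Hh.
      replace (1 - / 2 * 1) with (/ 2 * 1) by field. exact Hh.
    - destruct (Hterm (S n)) as (d' & Hd' & Hh).
      exists (Rmin d d'). split; [now apply Rmin_pos|]. intros h Ph Hn.
      specialize (IH h Ph (Rlt_le_trans _ _ _ Hn (Rmin_l _ _))).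
      specialize (Hh h Ph (Rlt_le_trans _ _ _ Hn (Rmin_r _ _))).
      rewrite !tech5. eapply Rle_trans; [apply (Rabs_combine _ _ _ _ IH Hh)|].
      right. simpl. field. }
  destruct (Hsum (N x)) as (d & Hd & Hh). destruct (HG x) as (d' & Hd' & Hz).
  exists (Rmin d d'). split; [now apply Rmin_pos|]. intros h Ph Hn.
  specialize (Hh h Ph (Rlt_le_trans _ _ _ Hn (Rmin_l _ _))).
  assert (Hn' := Rlt_le_trans _ _ _ Hn (Rmin_r _ _)).
  destruct (Hz x ltac:(now rewrite vdist_self)) as [-> Ex].
  destruct (Hz (vadd x h) ltac:(now rewrite vsub_vadd)) as [-> Eh].
  rewrite Eh in Hh.
  replace (sum_f_R0 (fun j => w j (vadd x h) * H j (vadd x h)) (N x)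
      - sum_f_R0 (fun j => w j x * H j x) (N x) - L h)
    with (sum_f_R0 (fun j => w j (vadd x h) * (H j (vadd x h) - v - L h)
        - w j x * (H j x - v)) (N x)).
  + apply (Rle_trans _ _ _ Hh). apply Rmult_le_compat_r; [apply vnorm_ge0|].
    specialize (Hpow (N x)). nra.
  (* Inserting [v] and [L h] into the sums is free, since the weights sum to 1 at both points. *)
  + apply eq_trans with (sum_f_R0 (fun j => w j (vadd x h) * H j (vadd x h)) (N x)
        - sum_f_R0 (fun j => w j x * H j x) (N x)
        - ((v + L h) * sum_f_R0 (fun j => w j (vadd x h)) (N x)
          - v * sum_f_R0 (fun j => w j x) (N x))).
    * rewrite !scal_sum, <- !minus_sum. apply sum_eq. intros; ring.
    * rewrite Eh, Ex. ring.
Qed.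

End Gluing.

(** * Local models *)

Section LocalModels.
Context {X : NormedSpace}.
Implicit Types (x y z p h : X) (P : X -> Prop) (F : X -> R).

Lemma C1_on_ext P f F (Df : X -> X -> R) :
  is_linear_subspace P -> (forall y, P y -> F y = f y) -> C1_on P f Df -> C1_on P F Df.
Proof.
intros (_ & Padd & _) E [H1 H2]. split; [|exact H2].
intros y Py. destruct (H1 y Py) as (Hl & Hb & H). split; [exact Hl|split; [exact Hb|]].
intros eps Heps. destruct (H eps Heps) as (d & Hd & Hh). exists d. split; [exact Hd|].
intros h Ph Hn. rewrite !E; auto.
Qed.

Lemma closed_complement_ball P p : is_closed_set P -> ~ P p ->
  exists r, 0 < r /\ forall x, vnorm (vsub x p) < r -> ~ P x.
Proof.
intros Hcl Hp. apply NNPP. intros Hn. apply Hp.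
assert (H : forall n : nat, exists x, P x /\ vnorm (vsub x p) < / (INR n + 1)).
{ intros n. apply NNPP. intros Hnn. apply Hn. exists (/ (INR n + 1)).
  split; [apply Rinv_0_lt_compat; pose proof (pos_INR n); lra|].
  intros x Hx Px. apply Hnn. now exists x. }
destruct (choice _ H) as [u Hu]. apply (Hcl u p); [apply Hu|].
intros eps Heps. destruct (archimed_cor1 eps Heps) as (N & HN & HN0).
exists N. intros n Hn'. apply (Rlt_trans _ (/ (INR n + 1))); [apply Hu|].
apply (Rlt_trans _ (/ INR N)); [|exact HN].
apply lt_0_INR in HN0. apply le_INR in Hn'. apply Rinv_lt_contravar; nra.
Qed.

Lemma approx_at_mono P f x L c c' : c <= c' -> approx_at P f x L c -> approx_at P f x L c'.
Proof.
intros Hc H eps Heps. destruct (H eps Heps) as (d & Hd & Hh). exists d.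
split; [exact Hd|]. intros h Ph Hn. apply (Rle_trans _ _ _ (Hh h Ph Hn)).
apply Rmult_le_compat_r; [apply vnorm_ge0|lra].
Qed.

(** The derivative of [G] on [X] restricts to one along [P], and [approx_at_unique] compares it with
    [Df]. The gap [c < eps] provides the strictness in [dual_norm_lt]. *)
Lemma is_C1_close_derivative P G (Df : X -> X -> R) c eps :
  is_linear_subspace P -> is_C1 G -> c < eps ->
  (forall y, P y -> linear_on P (Df y)) ->
  (forall y, P y -> approx_at P G y (Df y) c) ->
  exists DG, C1_on whole G DG /\
    forall y, P y -> dual_norm_lt P (fun h => Df y h - DG y h) eps.
Proof.
intros HP [DG HG] Hc HDf H. exists DG. split; [exact HG|].
intros y Py. exists c. split; [exact Hc|]. intros h Ph.
rewrite <- (Rplus_0_r c). apply (approx_at_unique P G y (Df y) (DG y)); auto.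
- destruct (proj1 HG y I) as ([Ga Gs] & _). split; intros; [apply Ga|apply Gs]; exact I.
- apply (approx_at_weaken whole); [intros; exact I|].
  apply frechet_approx_at. now apply HG.
Qed.

(** By continuity of the derivative, [Df y] is within [eta] of [Lam] on [P] near [p]; the mean value
    inequality on segments turns this into a Lipschitz bound for the Taylor remainder. *)
Lemma taylor_local P F (Df : X -> X -> R) p Lam eta :
  is_linear_subspace P -> C1_on P F Df -> P p -> 0 < eta ->
  linear_on whole Lam -> (forall h, P h -> Lam h = Df p h) ->
  exists r, 0 < r /\
    (forall y, P y -> vnorm (vsub y p) < r ->
      forall h, P h -> Rabs (Lam h - Df y h) <= eta * vnorm h) /\
    lipschitz_on (fun y => P y /\ vnorm (vsub y p) < r)
      (fun y => F y - (F p + Lam (vsub y p))) eta.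
Proof.
intros HP HF Pp Heta [La Ls] HLam.
destruct (C1_derivative_continuous P F Df p eta HF Pp Heta) as (r & Hr & Hc).
assert (Hc' : forall y, P y -> vnorm (vsub y p) < r ->
  forall h, P h -> Rabs (Df y h - Lam h) <= eta * vnorm h).
{ intros y Py Hy h Ph. rewrite HLam by exact Ph. auto. }
exists r. split; [exact Hr|]. split.
- intros y Py Hy h Ph. rewrite Rabs_minus_sym. auto.
- destruct HP as (P0 & Padd & Pscal).
  assert (Psub : forall x y, P x -> P y -> P (vsub x y)).
  { intros x y Px Py. unfold vsub. rewrite vopp_scal. auto. }
  intros x y [Px Hx] [Py Hy].
  replace (F x - (F p + Lam (vsub x p)) - (F y - (F p + Lam (vsub y p))))
    with (F x - F y - Lam (vsub x y)).
  2:{ rewrite <- (vsub_chain x y p), La by exact I. ring. }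
  apply (approx_at_segment P); [repeat split; auto|split; intros; [apply La|apply Ls]; exact I|auto|].
  intros t Ht. set (z := vadd y (vscal t (vsub x y))).
  assert (Pz : P z) by (apply Padd; auto).
  (* The ball is convex: [vsub z p] is a convex combination of [vsub y p] and [vsub x p]. *)
  assert (Hz : vnorm (vsub z p) < r).
  { unfold z. rewrite vsub_add.
    replace (vadd (vsub y p) (vscal t (vsub x y)))
      with (vadd (vscal (1 - t) (vsub y p)) (vscal t (vsub x p))).
    - eapply Rle_lt_trans; [apply vnorm_triangle|].
      rewrite !vnorm_scal, !Rabs_pos_eq by lra.
      apply Rle_lt_trans with (Rmax (vnorm (vsub y p)) (vnorm (vsub x p)));
        [|now apply Rmax_lub_lt].
      pose proof (Rmax_l (vnorm (vsub y p)) (vnorm (vsub x p))).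
      pose proof (Rmax_r (vnorm (vsub y p)) (vnorm (vsub x p))). nra.
    - rewrite <- (vsub_chain x y p), vscal_distr_v, (vadd_comm _ (vscal t (vsub x y))).
      rewrite vadd_assoc, <- vscal_distr_r.
      replace (1 - t + t) with 1 by ring. now rewrite vscal_1. }
  rewrite <- (Rplus_0_l eta). apply (approx_at_change P F z (Df z)).
  + now apply frechet_approx_at, HF.
  + now apply Hc'.
Qed.

Lemma approx_at_taylor P (Df : X -> X -> R) Delta Lam p a y c eta :
  linear_on whole Lam ->
  (forall h, P h -> Rabs (Lam h - Df y h) <= eta * vnorm h) ->
  approx_at whole Delta y (fun _ => 0) c ->
  approx_at P (fun x => a + Lam (vsub x p) + Delta x) y (Df y) (c + eta).
Proof.
intros [La _] HLam HD.
apply approx_at_change with (fun h => Lam h + 0).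
2:{ intros h Ph. rewrite Rplus_0_r. auto. }
rewrite <- (Rplus_0_l c).
apply (approx_at_add P (fun x => a + Lam (vsub x p)) Delta y Lam (fun _ => 0)).
- intros e He. exists 1. split; [lra|]. intros h _ _.
  rewrite vsub_add, La by exact I.
  replace (a + (Lam (vsub y p) + Lam h) - (a + Lam (vsub y p)) - Lam h) with 0 by ring.
  rewrite Rabs_R0. apply Rmult_le_pos; [lra|apply vnorm_ge0].
- apply (approx_at_weaken whole); [intros; exact I|exact HD].
Qed.

Lemma continuous_local_model C P F (Df : X -> X -> R) eps p :
  smoothing_constant X C -> is_linear_subspace P -> is_closed_set P ->
  C1_on P F Df -> continuous_on_X F -> 0 < eps ->
  exists r, 0 < r /\ forall delta, 0 < delta -> exists K, is_C1 K /\
    (forall x, vnorm (vsub x p) < r -> Rabs (K x - F x) < eps) /\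
    (forall y, P y -> vnorm (vsub y p) < r ->
      Rabs (K y - F y) <= delta /\ approx_at P K y (Df y) (eps / 2)).
Proof.
intros HC HP Hcl HF HFc Heps. assert (HC1 : 1 <= C) by apply HC.
destruct (classic (P p)) as [Pp|nPp].
2:{ destruct (closed_complement_ball P p Hcl nPp) as (r & Hr & Hdis).
    destruct (HFc p eps Heps) as (r' & Hr' & Hc).
    exists (Rmin r r'). split; [now apply Rmin_pos|]. intros delta _.
    exists (fun _ => F p). split; [apply is_C1_const|]. split.
    - intros x Hx. rewrite Rabs_minus_sym. apply Hc, (Rlt_le_trans _ _ _ Hx), Rmin_r.
    - intros y Py Hy. exfalso. apply (Hdis y); [|exact Py].
      apply (Rlt_le_trans _ _ _ Hy), Rmin_l. }
(* [C * eta] is the slope of the smoothed remainder and the other [eta] the distance from [Lam] to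
   [Df y]; together they use [eps / 2]. *)
set (eta := eps / (2 * (C + 1))).
assert (Heta : 0 < eta) by (apply Rdiv_lt_0_compat; lra).
assert (Heta' : C * eta + eta = eps / 2) by (unfold eta; field; lra).
destruct (frechet_bound _ _ _ _ (proj1 HF p Pp)) as (M & HM & HDM).
destruct (hahn_banach P (Df p) M HP (proj1 (proj1 HF p Pp)) HM HDM)
  as (Lam & HLam & HLamM & ELam).
destruct (taylor_local P F Df p Lam eta HP HF Pp Heta HLam ELam) as (r & Hr & Hder & Hlip).
destruct (HFc p (eps / 4) ltac:(lra)) as (r1 & Hr1 & Hc).
set (r2 := eps / (8 * (M + 1))).
assert (Hr2 : 0 < r2) by (apply Rdiv_lt_0_compat; lra).
assert (HMr2 : (M + 1) * r2 = eps / 8) by (unfold r2; field; lra).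
set (r3 := Rmin (Rmin r 1) (Rmin r1 r2)).
assert (r3 <= r /\ r3 <= 1 /\ r3 <= r1 /\ r3 <= r2) as (L0 & L1 & L2 & L3).
{ unfold r3. pose proof (Rmin_l (Rmin r 1) (Rmin r1 r2)).
  pose proof (Rmin_r (Rmin r 1) (Rmin r1 r2)).
  pose proof (Rmin_l r 1). pose proof (Rmin_r r 1).
  pose proof (Rmin_l r1 r2). pose proof (Rmin_r r1 r2). lra. }
exists r3. split; [repeat apply Rmin_pos; lra|]. intros delta Hdelta.
destruct (lipschitz_mcshane _ _ _ (Rlt_le _ _ Heta) Hlip) as (g & Hg & Eg).
destruct (proj2 HC g eta (Rlt_le _ _ Heta) Hg (Rmin delta (eps / 8))) as (D & CD & HD & LD).
{ apply Rmin_pos; lra. }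
exists (fun x => F p + Lam (vsub x p) + D x).
assert (HD1 : forall x, Rabs (g x - D x) < delta).
{ intros x. apply (Rlt_le_trans _ _ _ (HD x)), Rmin_l. }
assert (HD2 : forall x, Rabs (g x - D x) < eps / 8).
{ intros x. apply (Rlt_le_trans _ _ _ (HD x)), Rmin_r. }
split; [apply is_C1_add; [now apply (is_C1_affine Lam M)|exact CD]|]. split.
- intros x Hx.
  assert (Egp : g p = 0).
  { rewrite Eg by now rewrite vdist_self. rewrite vsub_self.
    destruct HLam as [_ Ls]. rewrite <- (vscal_0 vzero), Ls by exact I. ring. }
  specialize (Hc x ltac:(lra)). specialize (HLamM (vsub x p) I).
  specialize (Hg x p I I). rewrite Egp in Hg. specialize (HD2 x).
  pose proof (vnorm_ge0 (vsub x p)) as H0.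
  replace (F p + Lam (vsub x p) + D x - F x)
    with ((- (F x - F p) + Lam (vsub x p)) + (- (g x - D x) + (g x - 0))) by ring.
  (* The four errors come from the continuity of [F], the linear part, the smoothing, and [g], which
     vanishes at [p] and is [eta]-Lipschitz with [eta <= eps / 4] on a ball of radius at most 1. *)
  apply Rle_lt_trans with ((eps / 4 + eps / 8) + (eps / 8 + eps / 4)); [|lra].
  repeat apply Rabs_combine; rewrite ?Rabs_Ropp; try lra.
  + apply (Rle_trans _ _ _ HLamM). nra.
  + apply (Rle_trans _ _ _ Hg). nra.
- intros y Py Hy. split.
  + specialize (HD1 y). rewrite Eg in HD1 by (split; [exact Py|lra]).
    rewrite Rabs_minus_sym. replace (F y - (F p + Lam (vsub y p) + D y))
      with (F y - (F p + Lam (vsub y p)) - D y) by ring. lra.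
  + rewrite <- Heta'. apply approx_at_taylor; [exact HLam| |now apply lipschitz_approx_at].
    apply Hder; [exact Py|lra].
Qed.

(** Here the accuracy [delta] holds on the whole ball, not only on [P], so that gluing also controls
    the slope of [G] off [P]. The constant 51 covers [L] for the linear part and [25 * C * (2 * L)]
    for the correction, the remainder being [2 * L]-Lipschitz. *)
Lemma lipschitz_local_model C P F (Df : X -> X -> R) L eps p :
  smoothing_constant X C -> is_linear_subspace P -> is_closed_set P ->
  C1_on P F Df -> 0 < L -> lipschitz_on whole F L -> 0 < eps ->
  exists r, 0 < r /\ forall delta, 0 < delta -> exists K, is_C1 K /\
    (forall x, vnorm (vsub x p) < r -> Rabs (K x - F x) <= delta) /\
    lipschitz_on whole K (51 * C * L) /\
    (forall y, P y -> vnorm (vsub y p) < r -> approx_at P K y (Df y) (eps / 2)).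
Proof.
intros HC HP Hcl HF HL HFL Heps. assert (HC1 : 1 <= C) by apply HC.
destruct (classic (P p)) as [Pp|nPp].
2:{ destruct (closed_complement_ball P p Hcl nPp) as (r & Hr & Hdis).
    exists r. split; [exact Hr|]. intros delta Hdelta.
    destruct (proj2 HC F L (Rlt_le _ _ HL) HFL delta Hdelta) as (K & CK & HK & LK).
    exists K. split; [exact CK|]. split; [|split].
    - intros x _. rewrite Rabs_minus_sym. apply Rlt_le, HK.
    - apply (lipschitz_weaken _ _ (C * L)); [nra|exact LK].
    - intros y Py Hy. exfalso. now apply (Hdis y). }
set (eta := Rmin L (eps / (2 * (C + 1)))).
assert (H0 : 0 < eps / (2 * (C + 1))) by (apply Rdiv_lt_0_compat; lra).
assert (Heta : 0 < eta) by now apply Rmin_pos.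
assert (HetaL : eta <= L) by apply Rmin_l.
assert (Heta' : C * eta + eta <= eps / 2).
{ apply Rle_trans with ((C + 1) * (eps / (2 * (C + 1)))); [|right; field; lra].
  replace (C * eta + eta) with ((C + 1) * eta) by ring.
  apply Rmult_le_compat_l; [lra|apply Rmin_r]. }
(* The zero functional approximates an [L]-Lipschitz function with constant [L]; comparison with the
   derivative bounds [Df p], so Hahn-Banach keeps the slope [L]. *)
assert (HDL : dual_bound P (Df p) L).
{ intros h Ph. rewrite <- (Rminus_0_r (Df p h)), <- (Rplus_0_l L).
  apply (approx_at_unique P F p (Df p) (fun _ => 0)); auto using linear_on_0.
  - apply HF, Pp.
  - now apply frechet_approx_at, HF.
  - apply (approx_at_weaken whole); [intros; exact I|now apply lipschitz_approx_at]. }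
destruct (hahn_banach P (Df p) L HP (proj1 (proj1 HF p Pp)) (Rlt_le _ _ HL) HDL)
  as (Lam & HLam & HLamM & ELam).
destruct (taylor_local P F Df p Lam eta HP HF Pp Heta HLam ELam) as (r & Hr & Hder & Hlip).
exists r. split; [exact Hr|]. intros delta Hdelta.
assert (HFT : lipschitz_on whole (fun x => F x - (F p + Lam (vsub x p))) (2 * L)).
{ replace (2 * L) with (L + L) by ring.
  apply (lipschitz_add whole F (fun x => - (F p + Lam (vsub x p)))); [exact HFL|].
  intros x y Px Py. pose proof (lipschitz_affine Lam L p (F p) HLam HLamM x y Px Py) as H.
  rewrite <- Rabs_Ropp in H.
  now replace (- (F p + Lam (vsub x p)) - - (F p + Lam (vsub y p)))
    with (- (F p + Lam (vsub x p) - (F p + Lam (vsub y p)))) by ring. }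
destruct (smoothing_with_small_slope C HC _ _ (2 * L) eta delta
  ltac:(lra) ltac:(lra) Hdelta HFT Hlip) as (D & CD & HD & LD & HDs).
exists (fun x => F p + Lam (vsub x p) + D x).
split; [apply is_C1_add; [now apply (is_C1_affine Lam L)|exact CD]|]. split; [|split].
- intros x Hx. specialize (HD x). rewrite Rabs_minus_sym.
  replace (F x - (F p + Lam (vsub x p) + D x))
    with (F x - (F p + Lam (vsub x p)) - D x) by ring. lra.
- apply (lipschitz_weaken _ _ (L + 25 * C * (2 * L))); [nra|].
  apply lipschitz_add; [now apply lipschitz_affine|exact LD].
- intros y Py Hy. apply (approx_at_mono _ _ _ _ _ _ Heta').
  apply approx_at_taylor; [exact HLam|now apply Hder|]. apply HDs. now split.
Qed.

End LocalModels.

(** * Gluing the local models into the approximation [G] *)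

Theorem theorem2p4 (X : NormedSpace) (HB : is_Banach X) (Hstar : property_star X) :
  (* (i),(ii) *)
  (forall (P : X -> Prop) (f : X -> R) (Df : X -> X -> R) (F : X -> R),
     is_linear_subspace P -> is_closed_set P ->
     C1_on P f Df -> continuous_on_X F -> (forall y, P y -> F y = f y) ->
     forall eps, 0 < eps ->
       exists (G : X -> R) (DG : X -> X -> R),
         C1_on whole G DG /\
         (forall x, Rabs (F x - G x) < eps) /\
         (forall y, P y -> dual_norm_lt P (fun h => Df y h - DG y h) eps))
  /\
  (* (iii) *)
  (exists C2 : R,
   forall (P : X -> Prop) (f : X -> R) (Df : X -> X -> R) (F : X -> R),
     is_linear_subspace P -> is_closed_set P ->
     C1_on P f Df -> continuous_on_X F -> (forall y, P y -> F y = f y) ->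
     (exists Lf, lipschitz_on P f Lf) ->
     forall LF, is_Lip_on whole F LF ->
     forall eps, 0 < eps ->
       exists (G : X -> R) (DG : X -> X -> R),
         C1_on whole G DG /\
         (forall x, Rabs (F x - G x) < eps) /\
         (forall y, P y -> dual_norm_lt P (fun h => Df y h - DG y h) eps) /\
         lipschitz_on whole G (C2 * LF)).
Proof.
destruct (property_star_smoothing_constant Hstar) as [C HC].
assert (HC1 : 1 <= C) by apply HC.
split.
- intros P f Df F HP Hcl Hf HFc HFf eps Heps.
  assert (HF := C1_on_ext P f F Df HP HFf Hf).
  destruct (glue C _ (eps / 4) HC ltac:(lra)
    (fun p => continuous_local_model C P F Df eps p HC HP Hcl HF HFc Heps))
    as (G & CG & HG1 & HG2).
  destruct (is_C1_close_derivative P G Df (eps / 2 + eps / 4) eps) as (DG & HDG & Hclose);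
    [exact HP|exact CG|lra| | |].
  + intros y Py. apply (proj1 HF y Py).
  + intros y Py. apply (HG2 P y (F y)). intros p r delta K _ Hy [_ H]. now apply H.
  + exists G, DG. split; [exact HDG|]. split; [|exact Hclose].
    intros x. rewrite Rabs_minus_sym. apply HG1.
    intros p r delta K _ Hx [H _]. now apply H.
(* The models have slope [51 * C * LF]; gluing adds [tau], which is kept at most [LF]. *)
- exists (51 * C + 1).
  intros P f Df F HP Hcl Hf HFc HFf _ LF [HFL _] eps Heps.
  assert (HF := C1_on_ext P f F Df HP HFf Hf).
  destruct (Rlt_or_le 0 LF) as [HLF|HLF].
  + set (tau := Rmin (eps / 4) LF).
    assert (Htau : 0 < tau) by (apply Rmin_pos; lra).
    assert (Htau1 : tau <= eps / 4) by apply Rmin_l.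
    assert (Htau2 : tau <= LF) by apply Rmin_r.
    destruct (glue C _ tau HC Htau
      (fun p => lipschitz_local_model C P F Df LF eps p HC HP Hcl HF HLF HFL Heps))
      as (G & CG & HG1 & HG2).
    destruct (is_C1_close_derivative P G Df (eps / 2 + tau) eps) as (DG & HDG & Hclose);
      [exact HP|exact CG|lra| | |].
    * intros y Py. apply (proj1 HF y Py).
    * intros y Py. apply (HG2 P y (F y)). intros p r delta K _ Hy (H1 & _ & H2). auto.
    * exists G, DG. split; [exact HDG|]. split; [|split; [exact Hclose|]].
      -- intros x. rewrite Rabs_minus_sym. apply HG1.
         intros p r delta K Hd Hx [H _]. specialize (H x Hx). lra.
      -- apply (lipschitz_weaken _ _ (51 * C * LF + tau)); [nra|].
         apply approx_at_lipschitz. intros x. apply (HG2 whole x (F x)).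
         intros p r delta K _ Hx (H1 & H2 & _). split; [auto|].
         now apply lipschitz_approx_at.
  (* A Lipschitz bound [LF <= 0] forces [F] to be constant, so [G = F] works. *)
  + assert (Hconst : forall x, F vzero = F x).
    { intros x. specialize (HFL vzero x I I). pose proof (vnorm_ge0 (vsub vzero x)).
      pose proof (Rabs_pos (F vzero - F x)).
      destruct (Req_dec (F vzero - F x) 0) as [|Hne]; [lra|].
      apply Rabs_pos_lt in Hne. nra. }
    assert (CF : is_C1 F) by exact (is_C1_ext _ _ Hconst (is_C1_const _)).
    destruct (is_C1_close_derivative P F Df 0 eps) as (DF & HDF & Hclose);
      [exact HP|exact CF|lra| | |].
    * intros y Py. apply (proj1 HF y Py).
    * intros y Py. now apply frechet_approx_at, HF.
    * exists F, DF. split; [exact HDF|]. split; [|split; [exact Hclose|]].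
      -- intros x. now rewrite Rminus_diag, Rabs_R0.
      -- intros x y _ _. specialize (HFL x y I I). rewrite <- (Hconst x), <- (Hconst y) in *.
         rewrite Rminus_diag, Rabs_R0 in *. nra.
Qed.
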